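(* Let $K$ be a number field, let $S$ be a finite set of places of $K$, and let $\varphi:\mathbb{P}^1\to\mathbb{P}^1$ be a rational map of degree at least two defined over $K$. Let $Z\subset\mathbb{P}^1(K)$ be a finite set of points, and let $P\in\mathbb{P}^1(K)$. Then \[ \mathcal{O}_\varphi(P)\cap Z(K) \;=\; \mathrm{C}_S\bigl(\mathcal{O}_\varphi(P)\bigr)\cap Z(\mathsf{A}'_{K,S}). \]
   Context: For a place $v$ of $K$, $K_v$ denotes the completion of $K$ at $v$. The $\varphi$-orbit of $P$ is $\mathcal{O}_\varphi(P)=\{P,\varphi(P),\varphi^2(P),\dots\}\subset\mathbb{P}^1(K)$. Let $\mathsf{A}'_{K,S}=\prod'_{v\notin S}K_v$ be the restricted product (adèles with the places in $S$ removed). The set of $\mathsf{A}'_{K,S}$-points of $\mathbb{P}^1$ is identified with $\prod_{v\notin S}\mathbb{P}^1(K_v)$ equipped with the product topology (each $\mathbb{P}^1(K_v)$ with its $v$-adic topology), and $\mathbb{P}^1(K)$ embeds diagonally into it. $\mathrm{C}_S(\mathcal{O}_\varphi(P))$ denotes the closure of the diagonally embedded orbit $\mathcal{O}_\varphi(P)$ in $\prod_{v\notin S}\mathbb{P}^1(K_v)$. For the finite set $Z$, $Z(\mathsf{A}'_{K,S})=\prod_{v\notin S}Z\subset\prod_{v\notin S}\mathbb{P}^1(K_v)$, i.e. the adelic points $(z_v)_{v\notin S}$ with every $z_v\in Z$; and $\mathcal{O}_\varphi(P)\cap Z(K)$ is identified with its diagonal image. *)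

(* Defs.v *)
From HB Require Import structures.
From mathcomp Require Import all_boot all_order all_algebra all_field.
From mathcomp Require Import reals exp.
From Stdlib Require List.
Set Implicit Arguments. Unset Strict Implicit. Unset Printing Implicit Defensive.
Import Order.TTheory GRing.Theory Num.Theory.
Local Open Scope ring_scope.

Definition is_absval (K : fieldType) (R : realType) (f : K -> R) : Prop :=
  [/\ forall x, 0 <= f x,
      forall x, (f x == 0) = (x == 0),
      forall x y, f (x * y) = f x * f y,
      forall x y, f (x + y) <= f x + f y
    & exists x, f x != 0 /\ f x != 1].

Definition absval (K : fieldType) (R : realType) := {f : K -> R | is_absval f}.

(* Two absolute values are equivalent (define the same place) iff one is a
   positive real power of the other. A place is an equivalence class. *)
Definition absval_equiv (K : fieldType) (R : realType) (v w : absval K R) : Prop :=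
  exists2 s : R, 0 < s & forall x, proj1_sig w x = powR (proj1_sig v x) s.

(* The places not in S (S a finite set of places, given by representatives). *)
Definition notin_places (K : fieldType) (R : realType) (S : seq (absval K R))
  (v : absval K R) : Prop := forall w, List.In w S -> ~ absval_equiv w v.

Definition place_outside (K : fieldType) (R : realType) (S : seq (absval K R)) :=
  {v : absval K R | notin_places S v}.

(* P^1(K) = K ∪ {∞}, with [None] the point at infinity. *)
Notation P1 K := (option (GRing.Field.sort K)) (only parsing).

(* Basic neighbourhoods of [a] in P^1(K) for the topology induced from
   P^1(K_v): [b] is eps-close to [a]. *)
Definition P1_nbhd (K : fieldType) (R : realType) (v : absval K R)
  (a : P1 K) (eps : R) (b : P1 K) : Prop :=
  let abs := proj1_sig v in
  match a, b with
  | Some a, Some b => abs (b - a) < eps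
  | None, None => True
  | None, Some b => eps^-1 < abs b
  | Some _, None => False
  end.

(* The rational map [x |-> f(x)/g(x)] on P^1(K), for coprime f, g. *)
Definition ratmap (K : fieldType) (f g : {poly K}) (a : P1 K) : P1 K :=
  match a with
  | Some x => if g.[x] == 0 then None else Some (f.[x] / g.[x])
  | None => if (size g < size f)%N then None
            else if (size f < size g)%N then Some 0
            else Some (lead_coef f / lead_coef g)
  end.

Definition ratmap_deg (K : fieldType) (f g : {poly K}) : nat :=
  (maxn (size f) (size g)).-1.

Definition in_fwd_orbit (K : fieldType) (phi : P1 K -> P1 K) (P Q : P1 K) : Prop :=
  exists n : nat, Q = iter n phi P.

(* ---------- Closure of the diagonal orbit in prod_{v notin S} P^1(K_v) ----------
   A family x lies in the closure iff every basic open neighbourhood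
   (finitely many coordinates T, radius eps) meets the diagonal orbit. *)
Definition in_adelic_orbit_closure (K : fieldType) (R : realType)
  (S : seq (absval K R)) (phi : P1 K -> P1 K) (P : P1 K)
  (x : place_outside S -> P1 K) : Prop :=
  forall (T : seq (place_outside S)) (eps : R), 0 < eps ->
    exists n : nat, forall v, List.In v T ->
      P1_nbhd (proj1_sig v) (x v) eps (iter n phi P).

(* Main.v *)
Require Import Defs.
From HB Require Import structures.
From mathcomp Require Import all_boot all_order all_algebra all_field.
From mathcomp Require Import boolp classical_sets reals sequences exp.
From mathcomp Require Import complex ring lra.
From Stdlib Require List.
Import Order.TTheory GRing.Theory Num.Theory.
Local Open Scope ring_scope.
Set Implicit Arguments. Unset Strict Implicit. Unset Printing Implicit Defensive.

(** Only the closure of a wandering orbit needs an argument: the orbit then stays away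
    from the finite set [Z] at some place [v] outside [S], as follows.

    Some fixed point [y] of [phi], in a number field [L], has a nonzero multiplier; in the
    coordinate [u] sending [y] to infinity, [phi] is [A / B] with [deg A = deg B + 1]. At
    all but finitely many places [v] one has [|A(u) / B(u)|_v = |u|_v] once [|u|_v > 1]. So
    if [|u_m|_v > 1] for one [m], the orbit stays for ever on a sphere around [y] which
    meets no other point of [Z] and does not accumulate at [y].

    Such a pair [(v, m)] exists. Otherwise all [u_m] are [S']-integers for a finite set
    [S'], so all [B(u_m)] are [S']-units, and the product formula gives, for the height
    [H_m], the sum over [S'] of [l_v(m) = log max(1, |u_m|_v)], that
    [H_(m+1) >= (deg A) H_m - O(1)]. But [phi] multiplies large values of [|u|_v] by a bounded
    factor, so a large [l_v] changes by [O(1)] at each step: a doubling of [H_m] requires at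
    every step a new place of [S'] to become large. Hence [H_m] is bounded, which contradicts
    Northcott's theorem.

    Places above [S'] are realised as pairs of a place of [Q] and an element of the Galois
    group of [L], with one extension to [L] fixed for each place of [Q]: the product
    formula is then the one of [Q], applied to norms. *)

(** * Extending p-adic absolute values to number fields *)

Lemma exprVB (F : fieldType) (x : F) a b : x != 0 -> (a <= b)%N ->
  x^-1 ^+ a * x ^+ b = x ^+ (b - a).
Proof.
by move=> x0 ab; rewrite -[in LHS](subnKC ab) exprD exprVn mulKf ?expf_neq0.
Qed.

(** * Maximal subrings that do not contain [1 / p] *)

Section MaximalSubring.
Variables (F : fieldType) (p : F).

(** Membership of 1 is required of nonempty [X] only: the union of the empty chain, which Zorn's
    lemma also considers, must satisfy the predicate. *)
Definition subring_avoiding (X : set F) : Prop :=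
  [/\ forall x, X x -> X 1,
      forall x y, X x -> X y -> X (x - y),
      forall x y, X x -> X y -> X (x * y)
    & ~ X p^-1].

Lemma maximal_subring_avoiding (X0 : set F) : subring_avoiding X0 -> X0 1 ->
  exists O : set F, [/\ subring_avoiding O, O 1
    & forall B, subring_avoiding B -> (forall x, O x -> B x) -> forall x, B x -> O x].
Proof.
move=> P0 X01.
have [C CP Ctot|O [PO Omax]] := @Zorn_bigcup F subring_avoiding.
  split.
  - by move=> x [X CX Xx]; exists X => //; have [h _ _ _] := CP _ CX; exact: h Xx.
  - move=> x y [X CX Xx] [Y CY Yy].
    have [XY|YX] := Ctot _ _ CX CY.
      by exists Y => //; have [_ h _ _] := CP _ CY; apply: h => //; exact: XY.
    by exists X => //; have [_ h _ _] := CP _ CX; apply: h => //; exact: YX.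
  - move=> x y [X CX Xx] [Y CY Yy].
    have [XY|YX] := Ctot _ _ CX CY.
      by exists Y => //; have [_ _ h _] := CP _ CY; apply: h => //; exact: XY.
    by exists X => //; have [_ _ h _] := CP _ CX; apply: h => //; exact: YX.
  - by move=> [X CX]; have [_ _ _] := CP _ CX.
(* A maximal set without 1 is empty, hence strictly contained in [X0]. *)
have [O1|nO1] := pselect (O 1); last first.
  exfalso; apply: (Omax X0) => //; split.
    by move=> x Ox; case: nO1; have [h _ _ _] := PO; exact: h Ox.
  by move=> /(_ _ X01).
exists O; split => // B PB OB x Bx; apply: contrapT => nOx.
by apply: (Omax B) => //; split=> // /(_ _ Bx).
Qed.

Variable O : set F.
Hypothesis p0 : p != 0.
Hypothesis (PO : subring_avoiding O) (O1 : O 1) (Op : O p).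
Hypothesis Omax : forall B, subring_avoiding B -> (forall x, O x -> B x) ->
  forall x, B x -> O x.

Lemma avoidingB x y : O x -> O y -> O (x - y). Proof. by case: PO => _ + _ _; apply. Qed.
Lemma avoidingM x y : O x -> O y -> O (x * y). Proof. by case: PO => _ _ + _; apply. Qed.
Lemma avoiding0 : O 0. Proof. by rewrite -(subrr 1); exact: avoidingB. Qed.
Lemma avoidingN x : O x -> O (- x).
Proof. by move=> h; rewrite -sub0r; apply: avoidingB => //; exact: avoiding0. Qed.
Lemma avoidingD x y : O x -> O y -> O (x + y).
Proof. by move=> hx hy; rewrite -[y]opprK; apply: avoidingB => //; exact: avoidingN. Qed.
Lemma avoiding_sum (I : Type) (r : seq I) (P : pred I) (G : I -> F) :
  (forall i, P i -> O (G i)) -> O (\sum_(i <- r | P i) G i).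
Proof. by move=> h; elim/big_rec: _ => [|i x Pi]; [exact: avoiding0|apply: avoidingD; exact: h]. Qed.
Lemma avoidingX x n : O x -> O (x ^+ n).
Proof. by move=> Ox; elim: n => [|n IH]; rewrite ?expr0 // exprS; exact: avoidingM. Qed.

(** Otherwise [O[x]] would avoid [1 / p], and maximality would put [x] in [O]. *)
Lemma adjoin_avoiding (x : F) : ~ O x ->
  exists q : {poly F}, (forall i, O q`_i) /\ q.[x] = p^-1.
Proof.
move=> nOx; apply: contrapT => nq; apply: nOx.
pose B : set F := fun z => exists q : {poly F}, (forall i, O q`_i) /\ q.[x] = z.
apply: (Omax (B := B)); last first.
- exists 'X; split=> [i|]; last by rewrite hornerX.
  by rewrite coefX; case: (i == 1)%N => //; exact: avoiding0.
- move=> z Oz; exists z%:P; split=> [i|]; last by rewrite hornerC.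
  by rewrite coefC; case: (i == 0)%N => //; exact: avoiding0.
split => //.
- move=> _ _; exists 1; split=> [i|]; last by rewrite hornerC.
  by rewrite coefC; case: (i == 0)%N => //; exact: avoiding0.
- move=> y z [q [hq <-]] [r [hr <-]]; exists (q - r); split=> [i|].
    by rewrite coefB; exact: avoidingB.
  by rewrite hornerD hornerN.
- move=> y z [q [hq <-]] [r [hr <-]]; exists (q * r); split=> [i|].
    by rewrite coefM; apply: avoiding_sum => j _; exact: avoidingM.
  by rewrite hornerM.
Qed.

(** Let [s = 1 - p c]. If [1 / s] were not in [O], then [1 / p = q(1 / s)], and a power [s^n] clears
    denominators: [s^n / p] is in [O]. As [s^n = 1 - p d], so would be [1 / p = s^n / p + d]. *)
Lemma unit_avoiding c : O c -> O (1 - p * c)^-1.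
Proof.
move=> Oc; set s := 1 - p * c.
have Os : O s by apply: avoidingB => //; exact: avoidingM.
have s0 : s != 0.
  apply/eqP => /eqP; rewrite subr_eq0 => /eqP h; have [_ _ _] := PO; apply.
  by rewrite -[p^-1]mulr1 h mulrA mulVf // mul1r.
apply: contrapT => /adjoin_avoiding [q [hq qp]].
have hs n : exists2 c', O c' & s ^+ n = 1 - p * c'.
  elim: n => [|n [d Od Ed]]; first by exists 0; rewrite ?expr0 ?mulr0 ?subr0 //; exact: avoiding0.
  exists (c + d - p * c * d); last by rewrite exprS Ed /s; ring.
  by do ?[apply: avoidingB|apply: avoidingD|apply: avoidingM].
have [e Oe Ee] : exists2 e, O e & p^-1 * s ^+ size q = e.
  exists (\sum_(i < size q) q`_i * s ^+ (size q - i)); last first.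
    rewrite -qp horner_coef mulr_suml; apply: eq_bigr => i _.
    by rewrite -mulrA exprVB // ltnW.
  by apply: avoiding_sum => i _; apply: avoidingM => //; exact: avoidingX.
have [d Od Ed] := hs (size q).
have [_ _ _] := PO; apply.
have -> : p^-1 = e + d.
  by rewrite -Ee Ed mulrBr mulr1 mulrA mulVf // mul1r subrK.
exact: avoidingD.
Qed.

(* Chevalley's argument: reduce the degrees of expressions of [1 / p] as polynomials
   in [x] and in [1 / x]. *)
Lemma valuation_avoiding x : x != 0 -> O x \/ O x^-1.
Proof.
move=> x0; apply: contrapT => /not_orP [nx nxV].
have [q [hq qx]] := adjoin_avoiding nx.
have [r [hr rx]] := adjoin_avoiding nxV.
have [k szk] : exists k, (size q + size r <= k)%N by exists (size q + size r)%N.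
elim: k x x0 {nx nxV} q r hq qx hr rx szk => [|k IH] x x0 q r hq qx hr rx szk.
  move: szk; rewrite leqn0 addn_eq0 => /andP[q0 _].
  move: q0 qx; rewrite size_poly_eq0 => /eqP ->; rewrite horner0 => /esym/eqP.
  by rewrite invr_eq0 (negPf p0).
wlog le_rq : x x0 q r hq qx hr rx szk / (size r <= size q)%N.
  move=> W; case: (leqP (size r) (size q)) => [|/ltnW] le; first exact: (W x x0 q r).
  by apply: (W x^-1 _ r q); rewrite ?invr_eq0 ?invrK // addnC.
have [_ _ _ npV] := PO.
case: (leqP (size r) 1) => [r1|r1].
  by apply: npV; rewrite -rx (size1_polyC r1) hornerC; exact: hr.
set m := (size r).-1; set n := (size q).-1.
have Er : size r = m.+1 by rewrite prednK // ltnW.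
have Eq : size q = n.+1 by rewrite prednK // (leq_trans _ le_rq) // ltnW.
have mn : (m <= n)%N by rewrite -ltnS -Er -Eq.
have Os := unit_avoiding (hr 0%N); set s := (1 - p * r`_0)^-1 in Os.
have s0 : 1 - p * r`_0 != 0.
  apply/eqP => /eqP; rewrite subr_eq0 => /eqP h; apply: npV.
  by rewrite -[p^-1]mulr1 h mulrA mulVf // mul1r; exact: hr.
(* Multiply [p r(1 / x) = 1] by [x^m] and solve for [x^m]: its coefficient [1 - p r_0] is a unit of
   [O]. *)
have xm : x ^+ m = s * p * \sum_(i < m) r`_i.+1 * x ^+ (m - i.+1).
  have : p * r.[x^-1] = 1 by rewrite rx divff.
  rewrite horner_coef Er big_ord_recl /= expr0 mulr1 mulrDr => h.
  have {}h : 1 - p * r`_0 = p * \sum_(i < m) r`_i.+1 * x^-1 ^+ i.+1.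
    by rewrite -[in LHS]h addrC addKr.
  apply: (mulfI s0); rewrite /s !mulrA divff // mul1r h -!mulrA; congr (_ * _).
  rewrite mulr_suml; apply: eq_bigr => i _; rewrite -mulrA; congr (_ * _).
  by rewrite exprVB.
pose t : {poly F} := \sum_(i < m) (s * p * r`_i.+1) *: 'X^(m - i.+1).
have tx : t.[x] = x ^+ m.
  rewrite xm mulr_sumr /t horner_sum; apply: eq_bigr => i _.
  by rewrite hornerZ hornerXn mulrA.
have szt : (size t <= m)%N.
  apply: (leq_trans (size_sum _ _ _)); apply/bigmax_leqP => i _.
  apply: (leq_trans (size_scale_leq _ _)).
  by rewrite size_polyXn subnSK // leq_subr.
have Ot i : O t`_i.
  rewrite coef_sum; apply: avoiding_sum => j _; rewrite coefZ coefXn.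
  by do ?apply: avoidingM => //; case: (_ == _) => //; exact: avoiding0.
(* The top term [q_n x^n] is rewritten through [x^n = x^(n - m) x^m], which lowers the size of
   [q]. *)
pose q' := \poly_(i < n) q`_i + q`_n *: ('X^(n - m) * t).
have nm : (0 < m)%N by rewrite -ltnS -Er.
have szq' : (size q' <= n)%N.
  apply: (leq_trans (size_polyD _ _)); rewrite geq_max size_poly /=.
  apply: (leq_trans (size_scale_leq _ _)).
  apply: (leq_trans (size_polyMleq _ _)); rewrite size_polyXn /=.
  by rewrite -[leqRHS](subnK mn) leq_add2l.
apply: (IH x x0 q' r _ _ hr rx).
- move=> i; rewrite coefD coef_poly coefZ coefXnM; apply: avoidingD.
    by case: ifP => _ //; exact: avoiding0.
  by apply: avoidingM => //; case: ifP => _ //; exact: avoiding0.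
- rewrite -qx [in RHS]horner_coef Eq big_ord_recr /= hornerD horner_poly hornerZ hornerM.
  by rewrite hornerXn tx -exprD subnK.
- by rewrite -ltnS (leq_trans _ szk) // ltn_add2r Eq ltnS.
Qed.
End MaximalSubring.

(** * Units and nonunits of a valuation ring *)

Section ValuationRing.
Variables (L : fieldType) (O : set L).
Hypotheses (O1 : O 1) (OB : forall x y, O x -> O y -> O (x - y))
  (OM : forall x y, O x -> O y -> O (x * y))
  (Oval : forall x, x != 0 -> O x \/ O x^-1).

Definition val_unit x := [/\ x != 0, O x & O x^-1].
(** The maximal ideal of [O]. The guard keeps 0 in it, since [0^-1 = 0] belongs to [O]. *)
Definition val_nonunit x := O x /\ (x != 0 -> ~ O x^-1).

Lemma val_ring0 : O 0. Proof. by rewrite -(subrr 1); exact: OB. Qed.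
Lemma val_ringN x : O x -> O (- x).
Proof. by move=> h; rewrite -sub0r; apply: OB => //; exact: val_ring0. Qed.
Lemma val_ringD x y : O x -> O y -> O (x + y).
Proof. by move=> hx hy; rewrite -[y]opprK; apply: OB => //; exact: val_ringN. Qed.
Lemma val_ringX x n : O x -> O (x ^+ n).
Proof. by move=> Ox; elim: n => [|n IH]; rewrite ?expr0 // exprS; exact: OM. Qed.

Lemma val_unit1 : val_unit 1. Proof. by split; rewrite ?invr1 ?oner_eq0. Qed.
Lemma val_unitM x y : val_unit x -> val_unit y -> val_unit (x * y).
Proof.
move=> [x0 Ox Oxi] [y0 Oy Oyi]; split; rewrite ?mulf_neq0 ?invfM //; exact: OM.
Qed.
Lemma val_unitV x : val_unit x -> val_unit x^-1.
Proof. by move=> [x0 Ox Oxi]; split; rewrite ?invr_eq0 ?invrK. Qed.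
Lemma val_unitX x n : val_unit x -> val_unit (x ^+ n).
Proof. by move=> h; elim: n => [|n IH]; [exact: val_unit1|rewrite exprS; exact: val_unitM]. Qed.

Lemma val_nonunitM a x : O a -> val_nonunit x -> val_nonunit (a * x).
Proof.
move=> Oa [Ox nx]; split=> [|ax0 Oax]; first exact: OM.
have [a0 x0] : a != 0 /\ x != 0 by move: ax0; rewrite mulf_eq0 negb_or => /andP.
apply: (nx x0); have -> : x^-1 = a * (a * x)^-1 by rewrite invfM mulVKf.
exact: OM.
Qed.

(** One of [x / y] and [y / x] lies in [O], so the sum is an [O]-multiple of one of the summands. *)
Lemma val_nonunitD x y : val_nonunit x -> val_nonunit y -> val_nonunit (x + y).
Proof.
move=> nx ny; have [->|x0] := eqVneq x 0; first by rewrite add0r.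
have [->|y0] := eqVneq y 0; first by rewrite addr0.
have xy : x / y != 0 by rewrite mulf_neq0 ?invr_eq0.
have [h|] := Oval xy.
  have -> : x + y = (x / y + 1) * y by field.
  by apply: val_nonunitM => //; exact: val_ringD.
rewrite invf_div => h; have -> : x + y = (1 + y / x) * x by field.
by apply: val_nonunitM => //; exact: val_ringD.
Qed.

Lemma val_nonunit_sum (I : Type) (r : seq I) (P : pred I) (G : I -> L) :
  (forall i, P i -> val_nonunit (G i)) -> val_nonunit (\sum_(i <- r | P i) G i).
Proof.
move=> h; elim/big_rec: _ => [|i x Pi]; last by apply: val_nonunitD; exact: h.
by split; [exact: val_ring0|rewrite eqxx].
Qed.

(** Divisibility in [O] is a total preorder, so comparing term after term finds a nonzero one that
    divides all the others. *)
Lemma val_dominant (I : eqType) (s : seq I) (t : I -> L) :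
  has (fun i => t i != 0) s ->
  exists2 i, i \in s /\ t i != 0 & forall j, j \in s -> O (t j / t i).
Proof.
elim: s => // a s IH /=; case: (boolP (has _ s)) => [/IH [i [si ti] hi] _|/hasPn ns].
  have [ta|ta] := eqVneq (t a) 0.
    exists i; rewrite ?inE ?si ?orbT // => j; rewrite inE => /orP [/eqP ->|/hi//].
    by rewrite ta mul0r; exact: val_ring0.
  have [h|] := Oval (mulf_neq0 ta (invr_neq0 ti)).
    by exists i; rewrite ?inE ?si ?orbT // => j; rewrite inE => /orP [/eqP ->|/hi//].
  rewrite invf_div => h; exists a; rewrite ?inE ?eqxx // => j.
  rewrite inE => /orP [/eqP ->|/hi hj]; first by rewrite divff.
  by have := OM hj h; rewrite mulrA divfK.
rewrite orbF => ta; exists a; rewrite ?inE ?eqxx // => j.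
rewrite inE => /orP [/eqP ->|/ns]; first by rewrite divff.
by rewrite negbK => /eqP ->; rewrite mul0r; exact: val_ring0.
Qed.

(** Divide by a dominant term: if no other term had the same valuation, [-1] would be a sum of
    nonunits. *)
Lemma val_sum_eq0 (n : nat) (t : 'I_n -> L) (k : 'I_n) :
  \sum_i t i = 0 -> t k != 0 ->
  exists i j, [/\ i != j, t i != 0, t j != 0 & val_unit (t i / t j)].
Proof.
move=> t0 tk; have [|i [_ ti] hi] := @val_dominant _ (enum 'I_n) t.
  by apply/hasP; exists k; rewrite ?mem_enum.
apply: contrapT => nex; have : val_nonunit (\sum_(j | j != i) t j / t i).
  apply: val_nonunit_sum => j ji; split=> [|tj Oij]; first by apply: hi; rewrite mem_enum.
  apply: nex; exists j, i; split => //; first by move: tj; rewrite mulf_eq0 negb_or => /andP [].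
  by split=> //; apply: hi; rewrite mem_enum.
have -> : \sum_(j | j != i) t j / t i = -1.
  move: t0; rewrite (bigD1 i) //= => /eqP; rewrite addrC addr_eq0 => /eqP h.
  by rewrite -mulr_suml h mulNr divff.
by case=> _; rewrite oppr_eq0 oner_eq0 invrN invr1 => /(_ isT); apply; exact: val_ringN.
Qed.
End ValuationRing.

Lemma dim_adjoin_degree (L : fieldExtType rat) (x : L) :
  (adjoin_degree 1 x <= \dim {:L})%N.
Proof.
by have := dim_Fadjoin 1 x; rewrite dimv1 muln1 => <-; rewrite dimvS ?subvf.
Qed.

(** * The p-adic absolute value attached to a valuation ring *)

Section PadicAbs.
Variables (L : fieldExtType rat) (p : nat).
Hypothesis p_pr : prime p.

Lemma natr_numfield_eq0 n : (n%:R == 0 :> L) = (n == 0)%N.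
Proof.
have -> : n%:R = (n%:R)%:A :> L by rewrite scaler_nat.
by rewrite scaler_eq0 oner_eq0 orbF pnatr_eq0.
Qed.
Lemma prime_numfield_neq0 : p%:R != 0 :> L. Proof. by rewrite natr_numfield_eq0 -lt0n prime_gt0. Qed.

(** Zorn's lemma is started at the image of the integers, which misses [1 / p]. *)
Lemma padic_valuation_ring : exists O : set L,
  [/\ O 1, forall x y, O x -> O y -> O (x - y),
     forall x y, O x -> O y -> O (x * y), ~ O p%:R^-1
     & forall x, x != 0 -> O x \/ O x^-1].
Proof.
have [||O [PO O1 Omax]] := @maximal_subring_avoiding L p%:R (fun x => exists n : int, x = n%:~R).
- split.
  + by move=> _ _; exists 1.
  + by move=> _ _ [n ->] [m ->]; exists (n - m); rewrite rmorphB.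
  + by move=> _ _ [n ->] [m ->]; exists (n * m); rewrite rmorphM.
  + case=> n /(congr1 (fun z => p%:R * z)); rewrite divff ?prime_numfield_neq0 // => h.
    have : ((p%:Z * n - 1)%:~R : L) == 0 by rewrite rmorphB rmorphM /= -h subrr.
    have -> : (p%:Z * n - 1)%:~R = ((p%:Z * n - 1)%:~R)%:A :> L by rewrite scaler_int.
    rewrite scaler_eq0 oner_eq0 orbF intr_eq0 subr_eq0 => /eqP /(congr1 absz).
    by rewrite abszM /= => /eqP; rewrite muln_eq1 => /andP[/eqP p1 _]; move: p_pr; rewrite p1.
- by exists 1.
have Op : O p%:R.
  elim: (p) => [|n IH]; first exact: (avoiding0 PO O1).
  by rewrite -addn1 natrD; exact: (avoidingD PO O1).
exists O; have [_ hB hM np] := PO; split => // x x0.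
exact: (valuation_avoiding prime_numfield_neq0 PO O1 Op Omax x0).
Qed.

Variable O : set L.
Hypotheses (O1 : O 1) (OB : forall x y, O x -> O y -> O (x - y))
  (OM : forall x y, O x -> O y -> O (x * y)) (Op : ~ O p%:R^-1)
  (Oval : forall x, x != 0 -> O x \/ O x^-1).
Let U := val_unit O.
Local Notation e := (\dim {:L})`!.
Let UM : forall x y, U x -> U y -> U (x * y) := val_unitM OM.
Let UV : forall x, U x -> U x^-1 := @val_unitV L O.

Lemma val_ring_nat n : O n%:R.
Proof. by elim: n => [|n IH]; [exact: val_ring0|rewrite -addn1 natrD; exact: val_ringD]. Qed.
(** The element [p] is a nonunit, as [1 / p] is not in [O]. If [n] were one too, so would be the
    Bezout combination [u n - v p = 1]. *)
Lemma coprime_val_unit n : coprime p n -> U n%:R.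
Proof.
move=> cpn; have n0 : (0 < n)%N.
  by case: n cpn => //; rewrite /coprime gcdn0 => /eqP p1; move: p_pr; rewrite p1.
split; [by rewrite natr_numfield_eq0 -lt0n|exact: val_ring_nat|].
apply: contrapT => nO; case: (egcdnP p n0) => u v; rewrite gcdnC (eqP cpn) => uv _.
have h1 : val_nonunit O (u%:R * n%:R).
  by apply: val_nonunitM => //; [exact: val_ring_nat|split=> //; exact: val_ring_nat].
have h2 : val_nonunit O (- v%:R * p%:R).
  apply: val_nonunitM => //; first by apply: (val_ringN O1 OB); exact: val_ring_nat.
  by split=> //; exact: val_ring_nat.
have [_] := val_nonunitD O1 OB OM Oval h1 h2.
rewrite -natrM uv natrD natrM mulNr addrAC subrr add0r oner_eq0 invr1.
by move/(_ isT); apply.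
Qed.

Lemma nat_val n : (0 < n)%N -> exists a : int, U (n%:R * p%:R ^ a).
Proof.
move=> n0; have [m cm En] := pfactor_coprime p_pr n0.
exists (- (logn p n)%:Z); rewrite {1}En natrM natrX exprnP -mulrA -expfzDr ?prime_numfield_neq0 //.
by rewrite subrr expr0z mulr1; exact: coprime_val_unit.
Qed.

Lemma rat_val (r : rat) : r != 0 -> exists a : int, U (r%:A * p%:R ^ a).
Proof.
move=> r0; have [|a Ha] := @nat_val `|numq r|%N; first by rewrite absz_gt0 numq_eq0.
have [|b Hb] := @nat_val `|denq r|%N; first by rewrite absz_gt0 denq_eq0.
exists (a - b).
have -> : r%:A * p%:R ^ (a - b) = (Num.sg (numq r))%:~R *
   (`|numq r|%N%:R * p%:R ^ a) * (`|denq r|%N%:R * p%:R ^ b)^-1 :> L.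
  rewrite -[in LHS](divq_num_den r) expfzDr ?prime_numfield_neq0 // -invr_expz [in RHS]invfM.
  rewrite (_ : (_ / _)%:A = (numq r)%:~R / (denq r)%:~R); last first.
    by rewrite -!in_algE fmorph_div !rmorph_int.
  rewrite {1}[numq r]intEsg {1}(_ : denq r = `|denq r|%N); last first.
    by rewrite gez0_abs // denq_ge0.
  rewrite rmorphM /=; ring.
apply: UM; last exact: UV; apply: UM => //.
move: r0; rewrite -numq_eq0; have [h|h|->] := ltrgtP (numq r) 0; rewrite ?eqxx // => _.
  by rewrite ltr0_sg // rmorphN rmorph1; split;
    rewrite ?oppr_eq0 ?oner_eq0 ?invrN ?invr1 //; exact: val_ringN.
by rewrite gtr0_sg //; exact: val_unit1.
Qed.

(* Two terms of the equation of [x] over [Q] have the same valuation. All degrees being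
   at most [dim L], the exponent [e = (dim L)!] works for every [x]. *)
Lemma val_exists x : x != 0 -> exists a : int, U (x ^+ e * p%:R ^ (- a)).
Proof.
move=> x0; set q := minPoly 1 x; set d := adjoin_degree 1 x.
have szq : size q = d.+1 by exact: size_minPoly.
have q0 : \sum_(i < d.+1) q`_i * x ^+ i = 0 by rewrite -szq -horner_coef minPolyxx.
have [|i [j [ij ti tj Uij]]] := val_sum_eq0 O1 OB OM Oval (k := ord_max) q0.
  have := monic_minPoly 1 x; rewrite monicE lead_coefE -/q szq /= => /eqP ->.
  by rewrite mul1r expf_neq0.
wlog ji : i j ij ti tj Uij / (j < i)%N.
  move=> W; case: (ltngtP i j) => h; [|exact: (W i j)|by move/eqP: ij; case; exact/val_inj].
  by apply: (W j i) => //; rewrite 1?eq_sym // -invf_div; exact: UV.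
have coefQ k : exists r : rat, q`_k = r%:A.
  by have /polyOverP/(_ k)/vlineP := minPolyOver 1 x.
have [ri Ei] := coefQ i; have [rj Ej] := coefQ j.
have [ri0 rj0] : ri != 0 /\ rj != 0.
  split; first by move: ti; rewrite Ei; apply: contraNneq => ->; rewrite scale0r mul0r.
  by move: tj; rewrite Ej; apply: contraNneq => ->; rewrite scale0r mul0r.
have [a Ha] := rat_val (mulf_neq0 ri0 (invr_neq0 rj0)).
(* This is the quotient of the units [r_i x^i / (r_j x^j)] and [(r_i / r_j) p^a]. *)
have Hx : U (x ^+ (i - j) * p%:R ^ (- a)).
  have := UM Uij (UV Ha); rewrite Ei Ej => h.
  rewrite (_ : x ^+ (i - j) * _ = ri%:A * x ^+ i / (rj%:A * x ^+ j) / ((ri / rj)%:A * p%:R ^ a)) //.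
  rewrite -[in x ^+ i](subnK (ltnW ji)) exprD -invr_expz -!in_algE fmorph_div /=.
  have pa : p%:R ^ a != 0 :> L by rewrite expfz_neq0 // prime_numfield_neq0.
  have xj : x ^+ j != 0 by rewrite expf_neq0.
  by field; rewrite xj pa !scaler_eq0 (negPf ri0) (negPf rj0) oner_eq0.
have dv : (i - j %| e)%N.
  rewrite dvdn_fact // subn_gt0 ji /= (leq_trans (leq_subr _ _)) //.
  by rewrite (leq_trans _ (dim_adjoin_degree x)) // -ltnS.
have [k Ek] := dvdnP dv; exists (a * k%:Z).
have := val_unitX O1 OM k Hx; rewrite exprMn -exprM [(_ * k)%N]mulnC -Ek.
by rewrite [X in _ * X]exprnP exprz_exp mulNr.
Qed.

Lemma val_p_ge0 (a : int) : O (p%:R ^ a) -> 0 <= a.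
Proof.
case: a => // n; rewrite NegzE -invr_expz => h; case: Op.
have -> : p%:R^-1 = p%:R ^+ n * p%:R ^- n.+1 :> L.
  by rewrite exprS invfM mulrCA divff ?mulr1 // expf_neq0 // prime_numfield_neq0.
by apply: OM => //; apply: val_ringX => //; exact: val_ring_nat.
Qed.

Lemma val_p_unique z (a b : int) : U (z * p%:R ^ (- a)) -> U (z * p%:R ^ (- b)) -> a = b.
Proof.
have W (c d : int) : U (z * p%:R ^ (- c)) -> U (z * p%:R ^ (- d)) -> d <= c.
  move=> hc hd; have := UM hd (UV hc); have [+ _ _] := hc; rewrite mulf_eq0 negb_or => /andP[z0 _].
  rewrite -subr_ge0 => -[_ + _]; rewrite invfM invr_expz opprK mulrACA divff // mul1r.
  by rewrite -expfzDr ?prime_numfield_neq0 // addrC => /val_p_ge0.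
by move=> ha hb; apply/eqP; rewrite eq_le !W.
Qed.

Lemma padic_absval_of_ring (R : realType) : exists v : L -> R,
  [/\ is_absval v, forall x y, v (x + y) <= Num.max (v x) (v y) & v p%:R = p%:R^-1].
Proof.
have /choice [a Ha] x : exists a : int, x != 0 -> U (x ^+ e * p%:R ^ (- a)).
  have [->|/val_exists [a h]] := eqVneq x 0; first by exists 0.
  by exists a.
have p1 : 1 < p%:R :> R by rewrite ltr1n prime_gt1.
have p0 : 0 < p%:R :> R by rewrite ltr0n prime_gt0.
have e0 : 0 < e%:R :> R by rewrite ltr0n fact_gt0.
have aM x y : x != 0 -> y != 0 -> a (x * y) = a x + a y.
  move=> x0 y0; apply: (val_p_unique (Ha _ (mulf_neq0 x0 y0))).
  have -> : (x * y) ^+ e * p%:R ^ (- (a x + a y)) =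
     (x ^+ e * p%:R ^ (- a x)) * (y ^+ e * p%:R ^ (- a y)).
    by rewrite mulrACA -exprMn -expfzDr ?prime_numfield_neq0 // opprD.
  by apply: UM; exact: Ha.
have aO x : x != 0 -> O x -> 0 <= a x.
  move=> x0 Ox; apply: val_p_ge0.
  have [h0 h1 h2] := Ha _ x0; have := OM (val_ringX O1 OM e Ox) h2.
  rewrite invfM invr_expz opprK mulrA divff ?expf_neq0 // mul1r //.
have ap : a p%:R = e.
  apply: (val_p_unique (Ha _ prime_numfield_neq0)); rewrite exprnP.
  rewrite -expfzDr ?prime_numfield_neq0 // subrr expr0z.
  exact: val_unit1.
(* As [a p = e], the division by [e] normalises [v p] to [1 / p]. *)
pose v x : R := if x == 0 then 0 else p%:R `^ (- (a x)%:~R / e%:R).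
have vgt0 x : x != 0 -> 0 < v x by rewrite /v => /negPf ->; rewrite powR_gt0.
have vM x y : v (x * y) = v x * v y.
  rewrite /v mulf_eq0; have [->|x0] /= := eqVneq x 0; first by rewrite mul0r.
  have [_|y0] /= := eqVneq y 0; first by rewrite mulr0.
  rewrite aM // -powRD; last by apply/implyP => _; rewrite gt_eqF.
  by congr (_ `^ _); rewrite rmorphD /= opprD mulrDl.
have v0 : v 0 = 0 by rewrite /v eqxx.
have vge0 x : 0 <= v x by have [->|/vgt0/ltW] := eqVneq x 0; rewrite ?v0.
have vmono x y : x != 0 -> y != 0 -> a x <= a y -> v y <= v x.
  rewrite /v => /negPf -> /negPf -> h; apply: ler_powR; first exact: ltW.
  by rewrite ler_pM2r ?invr_gt0 // lerN2 ler_int.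
have vU x y : v (x + y) <= Num.max (v x) (v y).
  (* Let [x] be the dominant summand: then [x + y = x (1 + y / x)] with [1 + y / x] in [O]. *)
  wlog Oyx : x y / x != 0 -> O (y / x).
    move=> W; have [->|x0] := eqVneq x 0; first by rewrite add0r v0 le_max lexx orbT.
    have [->|y0] := eqVneq y 0; first by rewrite addr0 v0 le_max lexx.
    have [h|] := Oval (mulf_neq0 y0 (invr_neq0 x0)); first exact: W.
    by rewrite invf_div => h; rewrite addrC maxC; apply: W.
  have [->|x0] := eqVneq x 0; first by rewrite add0r v0 le_max lexx orbT.
  have [->|xy0] := eqVneq (x + y) 0; first by rewrite v0 le_max vge0.
  rewrite le_max; apply/orP; left; apply: vmono => //.
  have E : x + y = x * (1 + y / x) by field.
  have n0 : 1 + y / x != 0 by move: xy0; rewrite E mulf_eq0 negb_or => /andP [].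
  by rewrite E aM // lerDl; apply: aO => //; apply: val_ringD => //; exact: Oyx.
have vp : v p%:R = p%:R^-1.
  rewrite /v (negPf prime_numfield_neq0) ap mulNr divff ?gt_eqF // powR_inv1 //; exact: ltW.
exists v; split => //; split => //.
- move=> x; have [->|x0] := eqVneq x 0; first by rewrite v0 eqxx.
  by rewrite gt_eqF // vgt0.
- move=> x y; apply: (le_trans (vU x y)).
  by rewrite ge_max lerDl lerDr !vge0.
exists p%:R; rewrite vp invr_eq0 gt_eqF //; split => //.
by rewrite invr_eq1 gt_eqF.
Qed.
End PadicAbs.

Lemma padic_absval_exists (L : fieldExtType rat) (R : realType) (p : nat) : prime p ->
  exists v : L -> R,
  [/\ is_absval v, forall x y, v (x + y) <= Num.max (v x) (v y) & v p%:R = p%:R^-1].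
Proof.
move=> p_pr; have [O [O1 OB OM Op Oval]] := padic_valuation_ring L p_pr.
exact: (padic_absval_of_ring p_pr O1 OB OM Op Oval).
Qed.

(** * Galois number fields *)

Lemma pchar_ratExt (L : fieldExtType rat) : [pchar L] =i pred0.
Proof.
move=> p; rewrite inE /=; apply/negbTE/negP => /andP[p_pr].
have -> : p%:R = (p%:R)%:A :> L by rewrite scaler_nat.
by rewrite scaler_eq0 oner_eq0 orbF pnatr_eq0 => /eqP p0; rewrite p0 in p_pr.
Qed.

Lemma separable_ratExt (L : fieldExtType rat) (K E : {subfield L}) : separable K E.
Proof. by apply/separableP => x _; apply: pcharf0_separable; exact: pchar_ratExt. Qed.

(** By the primitive element theorem [K] is generated by one [th], which is sent to a root in [C] of
    its minimal polynomial. *)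
Lemma numfield_embedding (K : fieldExtType rat) (C : numClosedFieldType) :
  inhabited {rmorphism K -> C}.
Proof.
have Eth := eq_adjoin_separable_generator (separable_ratExt 1 {:K}) (subvf _).
set th := separable_generator _ _ in Eth.
have /polyOver1P [p0 Ep] := minPolyOver 1 th.
have szp0 : (size p0 > 1)%N.
  by rewrite -(size_map_poly (in_alg K)) -Ep size_minPoly ltnS adjoin_degreeE
    divn_gt0 ?dimv1 // -{1}(dimv1 K) dimvS // sub1v.
have [al /rootP al0] : exists al, root (map_poly (ratr : rat -> C) p0) al.
  by apply/closed_rootP; rewrite size_map_poly gtn_eqF.
pose evK (q : {poly rat}) := (map_poly (in_alg K) q).[th].
pose evC (q : {poly rat}) := (map_poly (ratr : rat -> C) q).[al].
have ev0 q : evK q = 0 -> evC q = 0.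
  move=> q0; have : minPoly 1 th %| map_poly (in_alg K) q.
    by apply: minPoly_dvdp; [apply/polyOver1P; exists q|apply/rootP].
  by rewrite Ep dvdp_map => /dvdpP [r ->]; rewrite /evC rmorphM hornerM al0 mulr0.
have evKP x : {q | evK q = x}.
  apply: sig_eqW; have : x \in <<1; th>>%VS by rewrite -Eth memvf.
  by case/Fadjoin_polyP => _ /polyOver1P [q ->] ->; exists q.
(* A chosen polynomial representing [x] is evaluated at [al]; by [ev0] the choice does not
   matter. *)
pose h x := evC (sval (evKP x)).
have hP q : h (evK q) = evC q.
  rewrite /h; case: (evKP _) => r /= Er; apply/eqP; rewrite -subr_eq0 /evC.
  rewrite -hornerN -hornerD -rmorphB /=; apply/eqP/ev0.
  by rewrite /evK rmorphB hornerD hornerN -/(evK r) Er subrr.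
have ha : zmod_morphism h.
  move=> x y; have [q <-] := evKP x; have [r <-] := evKP y.
  by rewrite !hP /evK -hornerN -hornerD -rmorphB -/(evK _) hP /evC rmorphB hornerD hornerN.
have hm : monoid_morphism h.
  split=> [|x y].
    have <- : evK 1 = 1 by rewrite /evK rmorph1 hornerC.
    by rewrite hP /evC rmorph1 hornerC.
  have [q <-] := evKP x; have [r <-] := evKP y.
  by rewrite !hP /evK -hornerM -rmorphM -/(evK _) hP /evC rmorphM hornerM.
pose haM := GRing.isZmodMorphism.Build _ _ h ha.
pose hmM := GRing.isMonoidMorphism.Build _ _ h hm.
by constructor; exact: (HB.pack h haM hmM).
Qed.

(** [L] is generated by the roots in [algC] of the minimal polynomials of [y] and of the images of a
    basis of [K], so it is a splitting field over [Q]. The element [y] will be a fixed point of the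
    map. *)
Lemma galois_numfield (K : fieldExtType rat) (iota : {rmorphism K -> algC}) (y : algC) :
  exists (L : splittingFieldType rat) (j : {rmorphism L -> algC})
    (k : {rmorphism K -> L}) (y' : L),
    [/\ galois 1 {:L}, forall x, j (k x) = iota x & j y' = y].
Proof.
pose xs := y :: map iota (vbasis {:K}).
have [rs Ers] := closed_field_poly_normal (\prod_(x <- xs) minCpoly x).
have mon : \prod_(x <- xs) minCpoly x \is monic.
  by apply: monic_prod => x _; exact: minCpoly_monic.
rewrite (monicP mon) scale1r in Ers.
have xs_rs x : x \in xs -> x \in rs.
  move=> xxs; rewrite -root_prod_XsubC -Ers; apply/rootP.
  rewrite horner_prod; apply/eqP; rewrite prodf_seq_eq0; apply/hasP.
  by exists x => //=; have := root_minCpoly x.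
have [q Eq] : exists q : {poly rat}, \prod_(x <- xs) minCpoly x = map_poly ratr q.
  elim: (xs) => [|x s [q Eq]]; first by exists 1; rewrite big_nil rmorph1.
  by have [p [Ep _] _] := minCpolyP x; exists (p * q); rewrite big_cons Ep Eq rmorphM.
have [L0 [j [s1 Es1 gen1]]] := num_field_exists rs.
have L0_ax : FieldExt_isSplittingField _ L0.
  constructor; exists (\prod_(z <- s1) ('X - z%:P)); last by exists s1; rewrite ?eqpxx.
  apply/polyOver1P; exists q; apply: (map_poly_inj j).
  rewrite -map_poly_comp (eq_map_poly (g := ratr)); last first.
    by move=> r /=; rewrite rmorphZ_num rmorph1 mulr1.
  rewrite -Eq Ers -Es1 big_map rmorph_prod; apply: eq_bigr => z _.
  by rewrite rmorphB /= map_polyX map_polyC.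
pose L : splittingFieldType rat := HB.pack_for (splittingFieldType rat) L0 L0_ax.
have imj x : x \in rs -> exists z, j z = x.
  by rewrite -Es1 => /mapP [z _ ->]; exists z.
have kP x : {z | j z = iota x}.
  apply: sig_eqW; rewrite (coord_vbasis (memvf x)) rmorph_sum.
  have imb i : exists z, j z = iota (vbasis {:K})`_i.
    have [lt_i|ge_i] := ltnP i (size (vbasis {:K})).
      by apply/imj/xs_rs; rewrite inE; apply/orP; right; apply: map_f; rewrite mem_nth.
    by exists 0; rewrite nth_default // !rmorph0.
  have /fin_all_exists [b Eb] (i : 'I_(\dim {:K})) := imb i.
  exists (\sum_i coord (vbasis {:K}) i x *: b i); rewrite rmorph_sum /=.
  by apply: eq_bigr => i _; rewrite !rmorphZ_num Eb.
pose k x := sval (kP x).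
have kE x : j (k x) = iota x by rewrite /k; case: (kP x).
have ka : zmod_morphism k by move=> x z; apply: (fmorph_inj j); rewrite !(kE, rmorphB).
have km : monoid_morphism k.
  split=> [|x z]; apply: (fmorph_inj j); rewrite ?kE ?rmorph1 //.
  by rewrite !rmorphM /= !kE.
pose kaM := GRing.isZmodMorphism.Build K L k ka.
pose kmM := GRing.isMonoidMorphism.Build K L k km.
have [y' Ey] : exists z, j z = y by apply/imj/xs_rs; rewrite inE eqxx.
pose kRM : {rmorphism K -> L} := HB.pack k kaM kmM.
exists L, j, kRM, y'; split=> //.
by apply/and3P; split; [exact: sub1v|exact: separable_ratExt|exact: normalFieldf].
Qed.

(** * A fixed point that is not superattracting *)

Lemma closed_coprimep (C : closedFieldType) (p q : {poly C}) :
  (forall x, root p x -> ~ root q x) -> coprimep p q.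
Proof.
move=> h; rewrite /coprimep; apply/contraT => /closed_rootP [x].
by rewrite root_gcd => /andP [px qx]; case: (h x).
Qed.

(* If every fixed point had multiplier 0, the fixed points would be simple roots of
   [F = f - X g] and also roots of [F' + g], a nonzero polynomial of degree < deg F. *)
Lemma nonsuper_fixpoint (C : numClosedFieldType) (f g : {poly C}) :
  coprimep f g -> (2 <= (maxn (size f) (size g)).-1)%N -> size f != (size g).+1 ->
  exists y, [/\ f.[y] = y * g.[y], g.[y] != 0 & f^`().[y] - y * g^`().[y] != 0].
Proof.
move=> cop deg nsz; pose F := f - g * 'X.
have rF y : root F y -> f.[y] = y * g.[y].
  by move=> /rootP /eqP; rewrite /F !hornerE subr_eq0 mulrC => /eqP.
have gF y : root F y -> g.[y] != 0.
  move=> Fy; apply/negP => /eqP g0; have := coprimep_root (p := f) cop (x := y).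
  by rewrite g0 eqxx => h; apply/notF/h/rootP; rewrite rF // g0 mulr0.
have [rs EF] := closed_field_poly_normal F.
have dF y : F^`().[y] = f^`().[y] - y * g^`().[y] - g.[y].
  by rewrite /F derivB derivM derivX !hornerE; ring.
(* With [n + 1 = deg F], the coefficient of [X^n] in [F' + g] is [n + 1] times the leading
   coefficient of [f] if [deg f > deg g], and [-n] times that of [g] otherwise. *)
have [n [szF szQ Qn]] : exists n, [/\ size F = n.+2, (size (F^`() + g)%R <= n.+1)%N
    & (F^`() + g)`_n != 0].
  have szF' n : size F = n.+2 -> (size F^`() <= n.+1)%N.
    move=> E; have F0 : F != 0 by rewrite -size_poly_eq0 E.
    by rewrite -ltnS -E lt_size_deriv.
  have [lt_gf|le_fg] := ltnP (size g) (size f).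
    move: deg; rewrite (maxn_idPl (ltnW lt_gf)) => deg.
    have [e Ef] : exists e, size f = e.+2 by exists (size f).-2; case: (size f) deg => [|[]].
    have le_ge : (size g <= e)%N.
      by move: lt_gf nsz; rewrite Ef ltnS eqSS leq_eqVlt eq_sym => /orP [/eqP ->|//]; rewrite eqxx.
    have szF : size F = e.+2.
      rewrite -Ef /F size_polyDl // size_polyN Ef.
      by rewrite (leq_ltn_trans (size_polyMleq _ _)) // size_polyX addn2 /= !ltnS.
    exists e; split; rewrite ?szF //.
      by rewrite (leq_trans (size_polyD _ _)) // geq_max szF' //= (leq_trans le_ge).
    rewrite coefD coef_deriv [g`_ _]nth_default // addr0 mulrn_eq0 /=.
    by rewrite -[e.+1]/(e.+2.-1) -szF -lead_coefE lead_coef_eq0 -size_poly_eq0 szF.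
  move: deg; rewrite (maxn_idPr le_fg) => deg.
  have [e Eg] : exists e, size g = e.+3 by exists (size g).-2.-1; case: (size g) deg => [|[|[]]].
  have g0 : g`_e.+2 != 0.
    by rewrite -[e.+2]/(e.+3.-1) -Eg -lead_coefE lead_coef_eq0 -size_poly_eq0 Eg.
  have szF : size F = e.+4.
    have szgX : size (- (g * 'X)) = e.+4.
      by rewrite size_polyN size_mulX ?Eg // -size_poly_eq0 Eg.
    by rewrite /F addrC size_polyDl szgX // ltnS -Eg.
  exists e.+2; split; rewrite ?szF //.
    by rewrite (leq_trans (size_polyD _ _)) // geq_max szF' //= Eg.
  rewrite coefD coef_deriv /F coefB coefMX /= [f`_ _]nth_default; last by rewrite -Eg.
  by rewrite sub0r mulNrn mulrS opprD addrAC addNr add0r oppr_eq0 mulrn_eq0.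
have F0 : F != 0 by rewrite -size_poly_eq0 szF.
have rsF y : (y \in rs) = root F y.
  by rewrite EF rootZ ?lead_coef_eq0 // root_prod_XsubC.
have [/hasP [y yrs my]|/hasPn nr] :=
    boolP (has (fun y => f^`().[y] - y * g^`().[y] != 0) rs).
  by exists y; rewrite -?rF ?gF -?rsF.
exfalso; apply/negP: szQ; rewrite -ltnNge.
have Qr y : root F y -> root (F^`() + g) y.
  by move=> Fy; apply/rootP; rewrite hornerD dF subrK; apply/eqP/negPn/nr; rewrite rsF.
(* At a root of [F], [F'] equals [-g], which does not vanish there: the roots are simple, and
   [F' + g] has [n + 1] of them. *)
have urs : uniq rs.
  have : separable_poly F.
    rewrite unlock; apply: closed_coprimep => y Fy /rootP F'y; have := Qr y Fy.
    by rewrite rootE hornerD F'y add0r (negPf (gF y Fy)).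
  by rewrite EF (eqp_separable (eqp_scale _ _)) ?lead_coef_eq0 // separable_prod_XsubC.
have szrs : size rs = n.+1.
  by apply/eqP; rewrite -eqSS -szF EF size_scale ?lead_coef_eq0 // size_prod_XsubC.
rewrite -szrs; apply: max_poly_roots => //.
  by apply: contraNneq Qn => ->; rewrite coef0.
apply/allP => y.
by rewrite rsF => /Qr.
Qed.

(** * Heights along an orbit *)

(* Once a coordinate is large it only moves by bounded steps, so a doubling of the
   sum needs a new large coordinate at every step, and there are finitely many. *)
Lemma doubling_sum_bounded (R : realFieldType) (I : finType) (l : nat -> I -> R) (c : R) :
  0 <= c -> (forall m i, 0 <= l m i) ->
  (forall m i, c < l m i -> `|l m.+1 i - l m i| <= c) ->
  (forall m, 2 * (\sum_i l m i) - c <= \sum_i l m.+1 i) ->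
  exists B, forall m, \sum_i l m i <= B.
Proof.
(* A coordinate that has reached [T] stays above [c] during the next [#|I|] steps. *)
move=> c0 l0 lstep dbl; pose s : R := #|I|%:R; pose T := (s + 2) * c + 1.
(* If no coordinate outside [J] reaches [T], the sum grows by at most [s (c + T)], which contradicts
   the doubling above [B]. *)
pose B := s * (c + T) + c; exists B => m; rewrite leNgt; apply/negP => Bm.
have s0 : 0 <= s by exact: ler0n.
have T0 : 0 <= T by rewrite addr_ge0 // mulr_ge0 // addr_ge0.
have cB : c <= B by rewrite lerDr mulr_ge0 // addr_ge0.
(* From a sum above [B] at time [m], each step adds a coordinate to [J]; [#|I| + 1] steps yield too
   many. *)
have [|_ [J [cJ _]]] : (#|I|.+1 <= #|I|.+1)%N -> B < \sum_i l (m + #|I|.+1)%N i /\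
    exists J : {set I}, #|J| = #|I|.+1 /\ forall i, i \in J -> T - #|I|.+1%:R * c <= l (m + #|I|.+1)%N i.
- move: {1 3 4 5 6}#|I|.+1 => j; elim: j => [|j IH] lej.
    rewrite addn0; split=> //; exists finset.set0; split=> [|i]; first by rewrite cards0.
    by rewrite inE.
  have [Bj [J [cJ hJ]]] := IH (ltnW lej); rewrite addnS; set k := (m + j)%N in Bj hJ *.
  have := dbl k; set H := \sum_i l k i in Bj *; set H' := \sum_i _ => dblk.
  split; first by lra.
  have js : j%:R <= s by rewrite ler_nat.
  have hlow i : i \in J -> T - j.+1%:R * c <= l k.+1 i /\ l k.+1 i <= l k i + c.
    move=> iJ; have lik := hJ i iJ; have : c < l k i.
      apply: lt_le_trans lik; have : j%:R * c <= s * c by rewrite ler_wpM2r.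
      by rewrite /T; lra.
    by move/lstep; rewrite ler_norml -natr1 mulrDl => /andP [h1 h2]; split; lra.
  have [/existsP [i /andP [niJ Ti]]|/existsPn nex] := boolP [exists i, (i \notin J) && (T <= l k.+1 i)].
    exists (i |: J); split=> [|i']; first by rewrite cardsU1 niJ cJ.
    rewrite inE => /orP [|/hlow [] //]; rewrite inE => /eqP ->.
    by apply: le_trans Ti; rewrite lerBlDr lerDl mulr_ge0.
  exfalso; have : H' <= \sum_i (l k i + (c + T)).
    apply: ler_sum => i _; have [iJ|niJ] := boolP (i \in J).
      by have [_ h] := hlow i iJ; lra.
    by have := nex i; rewrite niJ /= -ltNge => h; have := l0 k i; lra.
  rewrite big_split /= sumr_const -[#|_|]/(#|I|) -/H -mulr_natl -/s.
  by move: Bj; rewrite /B; lra.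
- by [].
by have := max_card (mem J); rewrite cJ ltnn.
Qed.

(** * Absolute values and growth of polynomials *)

Section AbsVal.
Variables (K : fieldType) (R : realType) (v : K -> R).
Hypothesis av : is_absval v.

Lemma absv_ge0 x : 0 <= v x. Proof. by case: av. Qed.
Lemma absv_eq0 x : (v x == 0) = (x == 0). Proof. by case: av. Qed.
Lemma absvM x y : v (x * y) = v x * v y. Proof. by case: av. Qed.
Lemma absvD x y : v (x + y) <= v x + v y. Proof. by case: av. Qed.
Lemma absv0 : v 0 = 0. Proof. by apply/eqP; rewrite absv_eq0. Qed.
Lemma absv_gt0 x : (0 < v x) = (x != 0). Proof. by rewrite lt_def absv_eq0 absv_ge0 andbT. Qed.
Lemma absv1 : v 1 = 1.
Proof.
by apply: (mulfI (x := v 1)); rewrite ?absv_eq0 ?oner_eq0 // -absvM !mulr1.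
Qed.
Lemma absvX x n : v (x ^+ n) = v x ^+ n.
Proof. by elim: n => [|n IH]; rewrite ?absv1 // !exprS absvM IH. Qed.
Lemma absvN1 : v (-1) = 1.
Proof.
apply/eqP; rewrite -(@eqrXn2 _ 2) ?absv_ge0 // -absvX expr1n.
by rewrite expr2 mulrNN mulr1 absv1.
Qed.
Lemma absvN x : v (- x) = v x. Proof. by rewrite -mulN1r absvM absvN1 mul1r. Qed.
Lemma absvV x : v x^-1 = (v x)^-1.
Proof.
have [->|x0] := eqVneq x 0; first by rewrite invr0 absv0 invr0.
by apply: (mulfI (x := v x)); rewrite ?absv_eq0 // -absvM !divff ?absv1 ?absv_eq0.
Qed.
Lemma absv_sum (I : Type) (r : seq I) (P : pred I) (G : I -> K) :
  v (\sum_(i <- r | P i) G i) <= \sum_(i <- r | P i) v (G i).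
Proof.
elim/big_rec2: _ => [|i x y _ h]; first by rewrite absv0.
by rewrite (le_trans (absvD _ _)) // lerD2l.
Qed.
Lemma absv_prod (I : Type) (r : seq I) (P : pred I) (G : I -> K) :
  v (\prod_(i <- r | P i) G i) = \prod_(i <- r | P i) v (G i).
Proof. exact: (big_morph v absvM absv1). Qed.

(** A restriction to a smaller field could be trivial; since morphisms fix the integers, [n]
    witnesses that it is not. *)
Lemma absval_comp (K' : fieldType) (h : {rmorphism K' -> K}) n :
  v n%:R != 0 -> v n%:R != 1 -> is_absval (v \o h).
Proof.
move=> n0 n1; split=> [x|x|x y|x y|] /=.
- exact: absv_ge0.
- by rewrite absv_eq0 fmorph_eq0.
- by rewrite rmorphM absvM.
- by rewrite rmorphD absvD.
- by exists n%:R; rewrite rmorph_nat.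
Qed.

Lemma absv_horner_ub (q : {poly K}) : exists2 M : R, 1 <= M &
  forall u t, v u <= t -> 1 <= t -> v q.[u] <= M * t ^+ (size q).-1.
Proof.
exists (1 + \sum_(i < size q) v q`_i) => [|u t ut t1].
  by rewrite lerDl sumr_ge0 // => i _; exact: absv_ge0.
rewrite horner_coef mulrDl mul1r (le_trans (absv_sum _ _ _)) //.
rewrite -[leLHS]add0r lerD ?exprn_ge0 ?(le_trans ler01) // mulr_suml ler_sum // => i _.
rewrite absvM absvX ler_wpM2l ?absv_ge0 //.
apply: (@le_trans _ _ (t ^+ i)); first by rewrite lerXn2r ?nnegrE ?absv_ge0 ?(le_trans ler01).
by rewrite ler_weXn2l // -ltnS (ltn_predK (ltn_ord i)).
Qed.

Lemma absv_horner_lb (q : {poly K}) : q != 0 -> exists2 m : R, 0 < m &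
  exists2 C : R, 1 <= C &
    forall u, C < v u -> m * v u ^+ (size q).-1 <= v q.[u].
Proof.
(* The terms below the leading one are multiplied by [X], so that the bound has the exponent
   [deg q]. *)
move=> q0; have [M M1 hM] := absv_horner_ub (\poly_(i < (size q).-1) q`_i * 'X).
have lc0 : 0 < v (lead_coef q) by rewrite absv_gt0 lead_coef_eq0.
have M0 : 0 <= M by exact: le_trans M1.
have C0 : 0 <= 2 * M / v (lead_coef q) by rewrite divr_ge0 ?mulr_ge0 // ltW.
exists (v (lead_coef q) / 2); first by rewrite divr_gt0.
(* Beyond this bound the lower terms are at most half of the leading one. *)
exists (1 + 2 * M / v (lead_coef q)); first by rewrite lerDl.
move=> u Cu; have u1 : 1 < v u by apply: le_lt_trans Cu; rewrite lerDl.
have u0 : 0 < v u by apply: lt_trans u1.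
have := hM u (v u) (lexx _) (ltW u1); rewrite hornerM hornerX absvM => h.
set r := \poly_(i < _) _ in h; set n := (size q).-1 in r h *.
have Eq : q.[u] = r.[u] + lead_coef q * u ^+ n.
  rewrite horner_poly [LHS]horner_coef lead_coefE.
  by rewrite -[in LHS](prednK (n := size q)) ?size_poly_gt0 // big_ord_recr.
have hr : v r.[u] * v u <= M * v u ^+ n.
  apply: (le_trans h); rewrite ler_wpM2l //.
  rewrite ler_weXn2l // ?(ltW u1) //.
  rewrite -subn1 leq_subLR add1n; apply: (leq_trans (size_polyMleq _ _)).
  by rewrite size_polyX addn2 /= ltnS size_poly.
have hb : v (lead_coef q) * v u ^+ n <= v q.[u] + v r.[u].
  have -> : v (lead_coef q) * v u ^+ n = v (q.[u] - r.[u]).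
    by rewrite Eq addrAC subrr add0r absvM absvX.
  by rewrite (le_trans (absvD _ _)) // absvN.
have hr2 : v r.[u] <= v (lead_coef q) / 2 * v u ^+ n.
  have hC : M <= v (lead_coef q) / 2 * v u.
    have : 2 * M / v (lead_coef q) < v u by apply: le_lt_trans Cu; rewrite lerDr.
    by rewrite ltr_pdivrMr //; lra.
  rewrite -(ler_pM2r u0) (le_trans hr) // mulrAC ler_wpM2r // exprn_ge0 // ltW //.
move: hb hr2; set a := _ * v u ^+ n; rewrite mulrAC -/a; lra.
Qed.
End AbsVal.

(** * Effect of [A / B] on local heights *)

Section RationalMapLocal.
Variables (K : fieldType) (R : realType) (v : K -> R).
Hypothesis av : is_absval v.
Variables A B : {poly K}.
Hypotheses (cop : coprimep A B) (szAB : size A = (size B).+1) (B0 : B != 0).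

Lemma absv_coprime_lb : exists2 c : R, 0 < c &
  forall u, c * Num.max 1 (v u) ^+ (size B) <= Num.max (v A.[u]) (v B.[u]).
Proof.
have A0 : A != 0 by rewrite -size_poly_eq0 szAB.
have [m m0 [C C1 hlb]] := absv_horner_lb av A0; rewrite szAB /= in hlb.
have /Bezout_eq1_coprimepP [[U V] /= E] := cop.
have [M M1 hM] := absv_horner_ub av U; have [N N1 hN] := absv_horner_ub av V.
have C0 : 0 < C by apply: lt_le_trans C1.
set k := M * C ^+ (size U).-1 + N * C ^+ (size V).-1.
have k0 : 0 < k by rewrite addr_gt0 // mulr_gt0 ?exprn_gt0 // (lt_le_trans ltr01).
have kC : 0 < (k * C ^+ size B)^-1 by rewrite invr_gt0 mulr_gt0 // exprn_gt0.
exists (Num.min m (k * C ^+ size B)^-1) => [|u]; first by rewrite lt_min m0 kC.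
have [Cu|uC] := ltP C (v u).
  rewrite le_max; apply/orP; left; apply: le_trans (hlb _ Cu).
  rewrite (max_idPr _); last by rewrite ltW // (le_lt_trans C1).
  by rewrite ler_wpM2r ?exprn_ge0 ?(absv_ge0 av) // ge_min lexx.
apply: (@le_trans _ _ ((k * C ^+ size B)^-1 * C ^+ size B)).
  rewrite ler_pM ?le_min ?(ltW m0) ?(ltW kC) //.
  - by rewrite exprn_ge0 // le_max ler01.
  - by rewrite ge_min lexx orbT.
  - by rewrite lerXn2r ?nnegrE ?le_max ?ler01 ?(ltW C0) // ge_max C1.
rewrite invfM -mulrA mulVf ?expf_neq0 ?gt_eqF // mulr1 -[k^-1]mul1r ler_pdivrMr // mulrC.
set w := Num.max _ _; have : v (U.[u] * A.[u] + V.[u] * B.[u]) = 1.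
  by rewrite -!hornerM -hornerD E hornerC (absv1 av).
move=> <-; apply: (le_trans (absvD av _ _)); rewrite !(absvM av) /k mulrDl.
by apply: lerD; apply: ler_pM; rewrite ?(absv_ge0 av) ?hM ?hN // le_max lexx ?orbT.
Qed.

Lemma absv_ratio_large : exists C D : R, [/\ 1 <= C, 1 <= D &
  forall u, C < v u -> v u / D <= v (A.[u] / B.[u]) /\ v (A.[u] / B.[u]) <= D * v u].
Proof.
have A0 : A != 0 by rewrite -size_poly_eq0 szAB.
have [mA mA0 [CA CA1 hA]] := absv_horner_lb av A0; rewrite szAB /= in hA.
have [mB mB0 [CB CB1 hB]] := absv_horner_lb av B0.
have [MA MA1 hMA] := absv_horner_ub av A; have [MB MB1 hMB] := absv_horner_ub av B.
have MA0 : 0 < MA by apply: lt_le_trans MA1.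
have MB0 : 0 < MB by apply: lt_le_trans MB1.
exists (CA + CB), (1 + MB / mA + MA / mB); split.
- by rewrite (le_trans CA1) // lerDl (le_trans ler01).
- by rewrite -addrA lerDl addr_ge0 // divr_ge0 // ltW.
move=> u; set x := v u => Cx; set D := 1 + _ + _.
have xA : CA < x by apply: le_lt_trans Cx; rewrite lerDl (le_trans ler01).
have xB : CB < x by apply: le_lt_trans Cx; rewrite lerDr (le_trans ler01).
have x1 : 1 <= x by rewrite (le_trans CA1) // ltW.
have x0 : 0 < x by rewrite (lt_le_trans ltr01).
have D1 : MB / mA <= D by rewrite /D addrAC lerDr addr_ge0 // divr_ge0 // ltW.
have D2 : MA / mB <= D by rewrite /D lerDr addr_ge0 // divr_ge0 // ltW.
have D0 : 0 < D by rewrite (lt_le_trans _ D2) // divr_gt0.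
move: (hA _ xA) (hB _ xB) (hMA _ _ (lexx x) x1) (hMB _ _ (lexx x) x1); rewrite szAB /=.
have -> : size B = (size B).-1.+1 by rewrite prednK // size_poly_gt0.
rewrite -/x /= exprS; set y := x ^+ _; have y0 : 0 < y by rewrite exprn_gt0.
move=> lA lB uA uB; rewrite (absvM av) (absvV av).
have vB0 : 0 < v B.[u] by rewrite (lt_le_trans _ lB) // mulr_gt0.
split.
  rewrite ler_pdivlMr // mulrAC ler_pdivrMr //.
  move: D1; rewrite ler_pdivrMr // => D1.
  apply: (@le_trans _ _ (x * (MB * y))); first by rewrite ler_wpM2l // ltW.
  apply: (@le_trans _ _ (D * (mA * (x * y)))); last by rewrite mulrC ler_wpM2r // ltW.
  have -> : x * (MB * y) = MB * (x * y) by ring.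
  by rewrite [leRHS]mulrA ler_wpM2r // ltW // mulr_gt0.
rewrite ler_pdivrMr //.
move: D2; rewrite ler_pdivrMr // => D2.
apply: (@le_trans _ _ (D * mB * (x * y))).
  by apply: (le_trans uA); rewrite ler_wpM2r // ltW // mulr_gt0.
have -> : D * mB * (x * y) = D * x * (mB * y) by ring.
by rewrite ler_wpM2l // ltW // mulr_gt0.
Qed.

Definition log_height (u : K) : R := ln (Num.max 1 (v u)).

Lemma log_height_ge0 u : 0 <= log_height u.
Proof. by rewrite ln_ge0 // le_max lexx. Qed.

(** The term [ln (v B(u))] completes the height of [A(u) / B(u)] to the logarithm of the maximum of
    [v A(u)] and [v B(u)], which [absv_coprime_lb] bounds from below; summed over the places, these
    terms will vanish by the product formula. *)
Lemma log_height_ratmap : exists2 c : R, 0 <= c &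
  (forall u, c < log_height u -> `|log_height (A.[u] / B.[u]) - log_height u| <= c) /\
  (forall u, B.[u] != 0 ->
    (size B)%:R * log_height u - c <= log_height (A.[u] / B.[u]) + ln (v B.[u])).
Proof.
have [c c0 hc] := absv_coprime_lb; have [C [D [C1 D1 hCD]]] := absv_ratio_large.
have lC : 0 <= ln C by rewrite ln_ge0.
have lD : 0 <= ln D by rewrite ln_ge0.
have D0 : 0 < D by apply: lt_le_trans D1.
have C0 : 0 < C by apply: lt_le_trans C1.
have m0 u : 0 < Num.max 1 (v u) by rewrite lt_max ltr01.
exists (`|ln c| + ln C + ln D); first by rewrite !addr_ge0.
split=> u => [hu|Bu].
  have Cu : C < v u.
    have : ln C < log_height u by apply: le_lt_trans hu; rewrite addrAC lerDr addr_ge0.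
    by rewrite /log_height ltr_ln ?posrE // lt_max => /orP [|//]; rewrite ltNge C1.
  have u1 : 1 < v u by apply: le_lt_trans Cu.
  have u0 : 0 < v u by apply: lt_trans u1.
  have [h1 h2] := hCD u Cu; set w := v (_ / _) in h1 h2.
  apply: (@le_trans _ _ (ln D)); last by rewrite lerDr addr_ge0.
  rewrite /log_height -/w (max_idPr (ltW u1)) ler_norml; apply/andP; split.
    rewrite lerBrDr addrC -lnV ?posrE // -lnM ?posrE ?invr_gt0 //.
    by rewrite ler_ln ?posrE ?mulr_gt0 ?invr_gt0 ?lt_max ?ltr01 // le_max h1 orbT.
  rewrite lerBlDr -lnM ?posrE // ler_ln ?posrE ?mulr_gt0 ?lt_max ?ltr01 // ge_max h2 andbT.
  by rewrite -[1]mulr1 ler_pM // ltW.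
have vB : 0 < v B.[u] by rewrite (absv_gt0 av).
have -> : log_height (A.[u] / B.[u]) + ln (v B.[u]) = ln (Num.max (v B.[u]) (v A.[u])).
  rewrite /log_height -lnM ?posrE // maxr_pMl ?(ltW vB) // mul1r -(absvM av) divfK //.
have := hc u; rewrite [leRHS]maxC => h.
have : ln (c * Num.max 1 (v u) ^+ size B) <= ln (Num.max (v B.[u]) (v A.[u])).
  by rewrite ler_ln ?posrE ?mulr_gt0 ?exprn_gt0 ?lt_max ?vB ?ltr01.
rewrite lnM ?posrE ?exprn_gt0 // lnXn // -/(log_height u) -mulr_natl => h'.
have := ler_norm (- ln c); rewrite normrN; move: (`|_|) => k hk; lra.
Qed.
End RationalMapLocal.

(** * Absolute values of number fields *)

Lemma bounded_powers_le1 (R : realType) (x B : R) :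
  0 <= x -> (forall k, x ^+ k <= B) -> x <= 1.
Proof.
move=> x0 h; rewrite leNgt; apply/negP => x1.
have bern k : 1 + (x - 1) * k%:R <= x ^+ k.
  elim: k => [|k IH]; first by rewrite mulr0 addr0 expr0.
  rewrite exprS -natr1; apply: (@le_trans _ _ (x * (1 + (x - 1) * k%:R))).
    have : 0 <= (x - 1) ^+ 2 * k%:R by rewrite mulr_ge0 // sqr_ge0.
    by lra.
  by rewrite ler_wpM2l.
have x10 : 0 < x - 1 by rewrite subr_gt0.
have B0 : 0 <= B by apply: le_trans (h 0%N); rewrite expr0.
have := archi_boundP (divr_ge0 B0 (ltW x10)); set k := Num.bound _ => hk.
have := le_trans (bern k) (h k); rewrite ltr_pdivrMr // in hk; lra.
Qed.

Lemma minPoly_rat (L : fieldExtType rat) (x : L) :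
  exists (d : nat) (c : 'I_d -> rat), [/\ (0 < d <= \dim {:L})%N
    & x ^+ d = - \sum_(i < d) (c i)%:A * x ^+ i].
Proof.
have := monic_minPoly 1 x; have := minPolyxx 1 x.
rewrite horner_coef monicE lead_coefE size_minPoly big_ord_recr /= => + /eqP lc.
rewrite lc mul1r addrC => /eqP; rewrite addr_eq0 => /eqP Ex.
have /fin_all_exists [c Ec] (i : 'I_(adjoin_degree 1 x)) :
    exists r : rat, (minPoly 1 x)`_i = r%:A.
  by have /polyOverP/(_ i)/vlineP := minPolyOver 1 x.
exists (adjoin_degree 1 x), c; split.
  rewrite dim_adjoin_degree andbT adjoin_degreeE divn_gt0 ?dimv1 //.
  by rewrite -{1}(dimv1 L) dimvS // sub1v.
by rewrite Ex; congr (- _); apply: eq_bigr => i _; rewrite Ec.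
Qed.

Lemma rat_numfieldE (L : fieldExtType rat) (r : rat) :
  r%:A = (numq r)%:~R / (denq r)%:~R :> L.
Proof. by rewrite -[in LHS](divq_num_den r) -in_algE fmorph_div !rmorph_int. Qed.

Section NumberFieldAbs.
Variables (L : fieldExtType rat) (R : realType).

Lemma absval_int (v : L -> R) (n : int) : is_absval v -> v n%:~R = v `|n|%N%:R.
Proof.
by move=> av; case: n => n //; rewrite NegzE rmorphN (absvN av).
Qed.

(** Otherwise nonzero rationals have absolute value 1, and the equation of [y] over [Q] bounds [v y]
    in terms of [L] alone. Applied to the powers of [x], this gives [v x <= 1]; the same for [1 / x]
    makes [v] trivial. *)
Lemma absval_prime (v : L -> R) : is_absval v -> exists2 p, prime p & v p%:R != 1.
Proof.
move=> av; apply: contrapT => nex.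
have vp p : prime p -> v p%:R = 1.
  by move=> pp; apply/eqP/negPn/negP => h; apply: nex; exists p.
have vn n : (0 < n)%N -> v n%:R = 1.
  elim/ltn_ind: n => n IH n0; have [n1|n1] := leqP n 1.
    by rewrite (_ : n = 1%N) ?(absv1 av) //; apply/eqP; rewrite eqn_leq n1.
  have /dvdnP [m Em] := pdiv_dvd n; have pp := pdiv_prime n1.
  rewrite Em natrM (absvM av) (vp _ pp) mulr1; apply: IH.
    rewrite [ltnRHS]Em ltn_Pmulr ?prime_gt1 //.
    by move: n0; rewrite Em muln_gt0 => /andP [].
  by move: n0; rewrite Em muln_gt0 => /andP [].
have vr r : v r%:A <= 1.
  have [->|r0] := eqVneq r 0; first by rewrite scale0r (absv0 av).
  rewrite rat_numfieldE (absvM av) (absvV av) !absval_int // !vn ?absz_gt0 ?numq_eq0 ?denq_eq0 //.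
  by rewrite invr1 mulr1.
have vd y : v y <= (\dim {:L})%:R + 1.
  have [d [c [/andP [d0 dn] Ey]]] := minPoly_rat y.
  have [h1|h1] := leP (v y) 1; first by rewrite (le_trans h1) // lerDr.
  have y0 : 0 < v y by apply: lt_trans h1.
  have : v y ^+ d <= d%:R * v y ^+ d.-1.
    rewrite -(absvX av) Ey (absvN av) (le_trans (absv_sum av _ _ _)) //.
    apply: (@le_trans _ _ (\sum_(i < d) v y ^+ d.-1)); last by rewrite sumr_const card_ord mulr_natl.
    apply: ler_sum => i _; rewrite (absvM av) (absvX av) -[leRHS]mul1r.
    rewrite ler_pM ?(absv_ge0 av) ?exprn_ge0 ?(absv_ge0 av) //.
    by rewrite ler_weXn2l ?(ltW h1) // -ltnS prednK.
  rewrite -{1}(prednK d0) exprS ler_pM2r ?exprn_gt0 // => h.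
  by rewrite (le_trans h) // (@le_trans _ _ (\dim {:L})%:R) ?ler_nat // lerDl.
have v1 x : v x <= 1.
  apply: (bounded_powers_le1 (absv_ge0 av x) (B := (\dim {:L})%:R + 1)) => k.
  by rewrite -(absvX av).
case: (av) => _ _ _ _ [x [x0 /negP]]; apply; rewrite (absv_eq0 av) in x0.
rewrite eq_le v1 /=; have := v1 x^-1; rewrite (absvV av) invf_le1 //.
by rewrite (absv_gt0 av).
Qed.

Lemma absval_comp_numfield (v : L -> R) (K : fieldType) (h : {rmorphism K -> L}) :
  is_absval v -> is_absval (v \o h).
Proof.
move=> av; have [p pp vp] := absval_prime av; apply: (absval_comp av _ _ vp).
by rewrite (absv_eq0 av) prime_numfield_neq0.
Qed.

(* [v] is a nonarchimedean absolute value whose residue characteristic does not divide [N]. *)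
Definition away_from (N : nat) (v : L -> R) : Prop :=
  [/\ is_absval v, forall x y, v (x + y) <= Num.max (v x) (v y) & v N%:R = 1].

Section Away.
Variables (N : nat) (v : L -> R).
Hypothesis hv : away_from N v.
Let av : is_absval v := let: And3 h _ _ := hv in h.

Lemma away_D t x y : v x <= t -> v y <= t -> v (x + y) <= t.
Proof. by case: hv => _ h _ hx hy; rewrite (le_trans (h _ _)) // ge_max hx hy. Qed.

Lemma away_sum t (I : Type) (r : seq I) (P : pred I) (G : I -> L) :
  0 <= t -> (forall i, P i -> v (G i) <= t) -> v (\sum_(i <- r | P i) G i) <= t.
Proof.
move=> t0 h; elim/big_rec: _ => [|i x Pi hx]; first by rewrite (absv0 av).
exact: away_D (h _ Pi) hx.
Qed.

Lemma away_nat n : v n%:R <= 1.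
Proof.
elim: n => [|n IH]; first by rewrite (absv0 av).
by rewrite -natr1; apply: away_D => //; rewrite (absv1 av).
Qed.

Lemma away_int n : v n%:~R <= 1.
Proof. by rewrite absval_int //; exact: away_nat. Qed.

Lemma away_M x y : v x <= 1 -> v y <= 1 -> v (x * y) <= 1.
Proof. by move=> hx hy; rewrite (absvM av) -[1]mulr1 ler_pM // (absv_ge0 av). Qed.

Lemma away_dvd D : (D %| N)%N -> away_from D v.
Proof.
case/dvdnP=> k Ek; case: hv => _ vU; rewrite Ek natrM (absvM av) => h.
split=> //; apply/eqP; rewrite eq_le away_nat /= -h -[leRHS]mul1r.
by rewrite ler_wpM2r ?(absv_ge0 av) // away_nat.
Qed.

Lemma away_horner (q : {poly L}) x : (forall i, v q`_i <= 1) -> v x <= 1 -> v q.[x] <= 1.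
Proof.
move=> hq hx; rewrite horner_coef; apply: away_sum => // i _; apply: away_M => //.
by rewrite (absvX av) exprn_ile1 ?(absv_ge0 av).
Qed.

(** Otherwise the Bezout combination [a n - b p = 1] would have absolute value less than 1. *)
Lemma away_coprime p n : prime p -> v p%:R = p%:R^-1 -> coprime p n -> v n%:R = 1.
Proof.
move=> pp vp cpn; have n0 : (0 < n)%N.
  by case: n cpn => //; rewrite /coprime gcdn0 => /eqP p1; move: pp; rewrite p1.
case: (egcdnP p n0) => a b; rewrite gcdnC (eqP cpn) => ab _.
apply/eqP; rewrite eq_le away_nat leNgt; apply/negP => n1.
have : v (a%:R * n%:R - b%:R * p%:R) < 1.
  case: hv => _ vU _; apply: (le_lt_trans (vU _ _)).
  rewrite gt_max (absvN av) !(absvM av); apply/andP; split.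
    by apply: le_lt_trans n1; rewrite -[leRHS]mul1r ler_wpM2r ?(absv_ge0 av) ?away_nat.
  apply: (@le_lt_trans _ _ (v p%:R)); first by rewrite -[leRHS]mul1r ler_wpM2r ?(absv_ge0 av) ?away_nat.
  by rewrite vp invf_lt1 ?ltr0n ?prime_gt0 // ltr1n prime_gt1.
by rewrite -!natrM ab natrD addrAC subrr add0r (absv1 av) ltxx.
Qed.
End Away.

(** [D] is the product of the denominators in the monic equation of [x] over [Q]: away from it, the
    coefficients are integral, hence so is [x]. *)
Lemma integral_away (x : L) : exists2 D : nat, (0 < D)%N &
  forall v, away_from D v -> v x <= 1.
Proof.
have [d [c [/andP [d0 _] Ex]]] := minPoly_rat x.
exists (\prod_(i < d) `|denq (c i)|)%N => [|v hv].
  by rewrite prodn_gt0 // => i; rewrite absz_gt0 denq_eq0.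
have av : is_absval v by case: hv.
have vc i : v (c i)%:A <= 1.
  have [|_ _ h] := @away_dvd _ _ hv `|denq (c i)|%N; first by rewrite (bigD1 i) //= dvdn_mulr.
  by rewrite rat_numfieldE (absvM av) (absvV av) [v (denq _)%:~R]absval_int // h invr1 mulr1 (away_int hv).
rewrite leNgt; apply/negP => x1.
have : v x ^+ d <= v x ^+ d.-1.
  rewrite -(absvX av) Ex (absvN av); apply: (away_sum hv) => [|i _].
    by rewrite exprn_ge0 // (absv_ge0 av).
  rewrite (absvM av) (absvX av) -[leRHS]mul1r ler_pM ?(absv_ge0 av) ?exprn_ge0 ?(absv_ge0 av) //.
  by rewrite ler_weXn2l ?(ltW x1) // -ltnS prednK.
rewrite -{1}(prednK d0) exprS ger_pMl ?leNgt ?x1 // exprn_gt0 // (lt_trans _ x1) //.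
Qed.

Lemma integral_away_seq (s : seq L) : exists2 D : nat, (0 < D)%N &
  forall v, away_from D v -> forall x, x \in s -> v x <= 1.
Proof.
elim: s => [|x s [D D0 hD]]; first by exists 1%N.
have [E E0 hE] := integral_away x; exists (E * D)%N => [|v hv y].
  by rewrite muln_gt0 E0.
rewrite inE => /orP [/eqP ->|]; first by apply/hE/(away_dvd hv)/dvdn_mulr.
by apply/hD/(away_dvd hv)/dvdn_mull.
Qed.
End NumberFieldAbs.

(** * Product formula and finiteness *)

Lemma normc_nat (R : rcfType) n : ComplexField.Normc.normc (n%:R : R[i]) = n%:R.
Proof.
have -> : n%:R = (n%:R)%:C%C :> R[i] by rewrite rmorph_nat.
by rewrite /= expr0n addr0 sqrtr_sqr normr_nat.
Qed.

Lemma archimedean_absval (L : fieldExtType rat) (R : realType) :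
  exists v : L -> R, is_absval v /\ forall n, v n%:R = n%:R.
Proof.
have [h] := numfield_embedding L R[i].
have hn n : ComplexField.Normc.normc (h n%:R) = n%:R by rewrite rmorph_nat normc_nat.
exists (fun x => ComplexField.Normc.normc (h x)); split=> //; split.
- by move=> x; case: (h x) => a b /=; exact: sqrtr_ge0.
- move=> x; apply/eqP/eqP => [/ComplexField.Normc.eq0_normc/eqP|->].
    by rewrite fmorph_eq0 => /eqP.
  by have := hn 0%N.
- by move=> x y; rewrite rmorphM ComplexField.Normc.normcM.
- by move=> x y; rewrite rmorphD; exact: le_normcD.
- by exists 2%:R; rewrite hn; split; rewrite ?pnatr_eq0 // pnatr_eq1.
Qed.

Section Places.
Variables (L : splittingFieldType rat) (R : realType).
Hypothesis galL : galois 1 {:L}.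
Variable place : nat -> L -> R.
Hypotheses (place0 : is_absval (place 0) /\ forall n, place 0 n%:R = n%:R)
  (placep : forall p, prime p -> [/\ is_absval (place p),
     forall x y, place p (x + y) <= Num.max (place p x) (place p y)
     & place p p%:R = p%:R^-1]).
Variable N : nat.
Hypothesis N0 : (0 < N)%N.

Local Notation s := (0%N :: primes N).
Local Notation I := ('I_(size s) * gal_of {:L})%type.
(** The entry 0 of [s] stands for the archimedean place. A place of [L] occurs once for every Galois
    element inducing it, which is the weight that the product formula needs. *)
Definition gal_place (i : I) (x : L) : R := place (nth 0%N s i.1) (i.2 x).

Lemma place_absval k : k \in s -> is_absval (place k).
Proof.
rewrite inE => /orP [/eqP ->|]; first by case: place0.
by rewrite mem_primes => /andP [/placep []].
Qed.

Lemma nth_place (i : 'I_(size s)) : nth 0%N s i \in s.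
Proof. by rewrite mem_nth. Qed.

Lemma gal_place_absval i : is_absval (gal_place i).
Proof. exact: absval_comp_numfield (i.2 : {rmorphism L -> L}) (place_absval (nth_place i.1)). Qed.

Lemma place_away p : prime p -> ~~ (p %| N)%N -> away_from N (place p).
Proof.
move=> pp pN; have [h1 h2 h3] := placep pp.
have h : away_from 1 (place p) by split => //; exact: absv1.
by split=> //; apply: (away_coprime h pp) => //; rewrite prime_coprime.
Qed.

Lemma place_prime p q : prime p -> prime q -> place p q%:R = if p == q then p%:R^-1 else 1.
Proof.
move=> pp pq; have [h1 h2 h3] := placep pp; case: eqVneq => [<-//|npq].
have h : away_from 1 (place p) by split => //; exact: absv1.
by apply: (away_coprime h pp) => //; rewrite prime_coprime // dvdn_prime2.
Qed.

(** Remove one prime [p] at a time: its archimedean absolute value cancels its p-adic one, and it is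
    a unit at the other places. *)
Lemma prod_places_nat n : (0 < n)%N -> (forall p, prime p -> (p %| n)%N -> (p %| N)%N) ->
  \prod_(k <- s) place k n%:R = 1.
Proof.
elim/ltn_ind: n => n IH n0 hn; have [n1|n1] := leqP n 1.
  have -> : n = 1%N by apply/eqP; rewrite eqn_leq n1.
  by rewrite big_seq big1 // => k /place_absval/absv1.
have /dvdnP [m Em] := pdiv_dvd n; have pp := pdiv_prime n1; set p := pdiv n in Em pp.
have m0 : (0 < m)%N by move: n0; rewrite Em muln_gt0 => /andP [].
have pN : (p %| N)%N by apply: hn => //; exact: pdiv_dvd.
transitivity (\prod_(k <- s) (place k m%:R * place k p%:R)).
  rewrite !big_seq; apply: eq_bigr => k /place_absval av.
  by rewrite Em natrM (absvM av).
rewrite big_split /= IH //; last first.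
- by move=> q pq qm; apply: hn => //; rewrite Em dvdn_mulr.
- by rewrite [ltnRHS]Em ltn_Pmulr ?prime_gt1.
rewrite mul1r big_cons; case: place0 => _ ->.
rewrite (bigD1_seq p) ?primes_uniq ?mem_primes ?pp ?N0 //= place_prime // eqxx.
rewrite big_seq_cond big1 => [|q]; first by rewrite mulr1 divff // pnatr_eq0 -lt0n prime_gt0.
by rewrite mem_primes => /andP [/andP [pq _] qp]; rewrite place_prime // (negPf qp).
Qed.

Lemma place_denq p (r : rat) : prime p -> (p %| `|denq r|)%N -> 1 < place p r%:A.
Proof.
move=> pp pd; have [av vU vp] := placep pp.
have h : away_from 1 (place p) by split => //; exact: absv1.
have cpn : coprime p `|numq r|.
  rewrite prime_coprime //; apply: contraL (coprime_num_den r) => pn.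
  apply/negP => /eqP g1; have : (p %| gcdn `|numq r| `|denq r|)%N by rewrite dvdn_gcd pn.
  by rewrite g1 dvdn1 => /eqP p1; rewrite p1 in pp.
rewrite rat_numfieldE (absvM av) (absvV av) !absval_int // (away_coprime h pp vp cpn) mul1r.
have d0 : 0 < place p `|denq r|%N%:R by rewrite (absv_gt0 av) natr_numfield_eq0 absz_eq0 denq_eq0.
rewrite invf_gt1 //; case/dvdnP: pd => k ->; rewrite natrM (absvM av) vp.
apply: (@le_lt_trans _ _ (1 * p%:R^-1)).
  by rewrite ler_wpM2r ?invr_ge0 // (away_nat h).
by rewrite mul1r invf_lt1 ?ltr0n ?prime_gt0 // ltr1n prime_gt1.
Qed.

Lemma place_numq p (r : rat) : prime p -> (p %| `|numq r|)%N -> place p r%:A < 1.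
Proof.
move=> pp pn; have [av vU vp] := placep pp.
have h : away_from 1 (place p) by split => //; exact: absv1.
have cpn : coprime p `|denq r|.
  rewrite prime_coprime //; apply: contraL (coprime_num_den r) => pd.
  apply/negP => /eqP g1; have : (p %| gcdn `|numq r| `|denq r|)%N by rewrite dvdn_gcd pn.
  by rewrite g1 dvdn1 => /eqP p1; rewrite p1 in pp.
rewrite rat_numfieldE (absvM av) (absvV av) !absval_int // (away_coprime h pp vp cpn) invr1 mulr1.
case/dvdnP: pn => k ->; rewrite natrM (absvM av) vp.
apply: (@le_lt_trans _ _ (1 * p%:R^-1)).
  by rewrite ler_wpM2r ?invr_ge0 // (away_nat h).
by rewrite mul1r invf_lt1 ?ltr0n ?prime_gt0 // ltr1n prime_gt1.
Qed.

(** A prime of the numerator or denominator of [r] divides [N]: otherwise its place would be away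
    from [N], and [r] not a unit there. *)
Lemma prod_places_rat (r : rat) : r != 0 ->
  (forall v : L -> R, away_from N v -> v r%:A = 1) -> \prod_(k <- s) place k r%:A = 1.
Proof.
move=> r0 hr.
have hd p : prime p -> (p %| `|denq r|)%N -> (p %| N)%N.
  move=> pp pd; apply: contraT => pN; have := place_denq pp pd.
  by rewrite hr ?ltxx //; exact: place_away.
have hn p : prime p -> (p %| `|numq r|)%N -> (p %| N)%N.
  move=> pp pn; apply: contraT => pN; have := place_numq pp pn.
  by rewrite hr ?ltxx //; exact: place_away.
transitivity (\prod_(k <- s) (place k `|numq r|%N%:R / place k `|denq r|%N%:R)).
  rewrite !big_seq; apply: eq_bigr => k /place_absval av.
  by rewrite rat_numfieldE (absvM av) (absvV av) !absval_int.
rewrite prodf_div !prod_places_nat ?invr1 ?mulr1 ?absz_gt0 ?numq_eq0 ?denq_eq0 //.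
Qed.

(** Over a fixed place of [Q], the product over the Galois group is the absolute value of the norm
    of [x], a rational number; it is a unit away from [N] because all conjugates of [x] are. *)
Lemma prod_gal_place x : x != 0 -> (forall v : L -> R, away_from N v -> v x = 1) ->
  \prod_(i : I) gal_place i x = 1.
Proof.
move=> x0 hx; pose nx := \prod_(g : gal_of {:L}) g x.
have /vlineP [r Er] : nx \in 1%VS.
  have := mem_galNorm galL (memvf x); rewrite /galNorm (eq_bigl xpredT) // => g.
  by rewrite gal_kHom ?sub1v // k1AHom.
have r0 : r != 0.
  apply: contraTneq isT => r0; move: Er; rewrite r0 scale0r => /eqP.
  by rewrite prodf_seq_eq0 => /hasP [g _]; rewrite /= fmorph_eq0 (negPf x0).
rewrite -[RHS](prod_places_rat r0) => [|v hv]; last first.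
  have [av vU vN] := hv; rewrite -Er (absv_prod av) big1 // => g _.
  rewrite -[LHS]/((v \o g) x); apply: hx; split.
  - exact: (absval_comp_numfield (g : {rmorphism L -> L}) av).
  - by move=> y z; rewrite /= rmorphD; exact: vU.
  - by rewrite /= rmorph_nat.
rewrite (big_nth 0%N) big_mkord.
transitivity (\prod_(k < size s) \prod_(g : gal_of {:L}) gal_place (k, g) x).
  by rewrite pair_bigA; apply: eq_bigr => -[].
by apply: eq_bigr => k _; rewrite -Er (absv_prod (place_absval (nth_place k))).
Qed.
End Places.

Lemma no_injection_nat (T : finType) (f : nat -> T) : ~ injective f.
Proof.
move=> inj; have := @leq_card _ _ (fun i : 'I_#|T|.+1 => f i).
by rewrite card_ord ltnn => h; apply/notF/h => i j /inj/val_inj.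
Qed.

Lemma away_from_gal (L : splittingFieldType rat) (R : realType) N (v : L -> R)
  (g : gal_of {:L}) : away_from N v -> away_from N (v \o g).
Proof.
move=> [av vU vN]; split.
- exact: (absval_comp_numfield (g : {rmorphism L -> L}) av).
- by move=> y z; rewrite /= rmorphD; exact: vU.
- by rewrite /= rmorph_nat.
Qed.

(** * Northcott's finiteness theorem *)

Section Northcott.
Variables (L : splittingFieldType rat) (R : realType).
Hypothesis galL : galois 1 {:L}.
Variable place : nat -> L -> R.
Hypotheses (place0 : is_absval (place 0) /\ forall n, place 0 n%:R = n%:R)
  (placep : forall p, prime p -> [/\ is_absval (place p),
     forall x y, place p (x + y) <= Num.max (place p x) (place p y)
     & place p p%:R = p%:R^-1]).
Variable N : nat.
Hypothesis N0 : (0 < N)%N.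
Local Notation s := (0%N :: primes N).
Local Notation gpl := (@gal_place L R place N).

(** Only primes dividing [N] occur in the denominator of [r], to bounded powers, so a fixed power of
    [N] clears it; the archimedean place then bounds the numerator. *)
Lemma bounded_rat (C : R) : 0 <= C -> exists e B : nat, forall r : rat,
  (forall v : L -> R, away_from N v -> v r%:A <= 1) ->
  (forall k, k \in s -> place k r%:A <= C) ->
  exists2 a : int, (`|a| <= B)%N & r%:A * (N ^ e)%:R = a%:~R :> L.
Proof.
(* As [C <= 2^e <= p^e], the exponent of [p] in the denominator is at most [e]. *)
move=> C0; pose e := Num.bound C.
have Ce : C <= 2 ^+ e.
  apply: (le_trans (ltW (archi_boundP C0))); rewrite -natrX ler_nat ltnW //.
  by rewrite ltn_expl.
have CN0 : 0 <= C * (N ^ e)%:R by rewrite mulr_ge0.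
exists e, (Num.bound (C * (N ^ e)%:R)) => r hr hC.
pose q : rat := r * (N ^ e)%:R.
have Eq : r%:A * (N ^ e)%:R = q%:A :> L by rewrite -!in_algE rmorphM rmorph_nat.
have dq : `|denq q|%N = 1%N.
  apply/eqP; rewrite eqn_leq absz_gt0 denq_eq0 andbT leqNgt; apply/negP => d1.
  have pp := pdiv_prime d1; have := place_denq placep pp (pdiv_dvd _).
  set p := pdiv _ in pp *; have [av vU vp] := placep pp.
  rewrite ltNge => /negP; apply; rewrite -Eq (absvM av) natrX (absvX av).
  have h : away_from 1 (place p) by split => //; exact: absv1.
  have [pN|pN] := boolP (p %| N)%N; last first.
    have hp := place_away placep pp pN.
    rewrite -[leRHS]mulr1 ler_pM ?exprn_ge0 ?(absv_ge0 av) ?hr //.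
    by rewrite exprn_ile1 ?(absv_ge0 av) ?(away_nat h).
  apply: (@le_trans _ _ (2 ^+ e * 2^-1 ^+ e)); last by rewrite -exprMn divff ?expr1n ?pnatr_eq0.
  apply: ler_pM; rewrite ?exprn_ge0 ?(absv_ge0 av) //.
    by apply: le_trans Ce; apply: hC; rewrite inE mem_primes pp N0 pN orbT.
  rewrite lerXn2r ?nnegrE ?(absv_ge0 av) ?invr_ge0 //.
  case/dvdnP: pN => k ->; rewrite natrM (absvM av) vp.
  apply: (@le_trans _ _ (1 * p%:R^-1)); first by rewrite ler_wpM2r ?invr_ge0 ?(away_nat h).
  by rewrite mul1r lef_pV2 ?posrE ?ltr0n ?prime_gt0 // ler_nat prime_gt1.
have Ea : q%:A = (numq q)%:~R :> L.
  rewrite rat_numfieldE; have -> : denq q = 1 by rewrite -[denq q]gez0_abs ?dq ?denq_ge0.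
  by rewrite divr1.
exists (numq q); last by rewrite Eq Ea.
have [av vn] := place0; rewrite -(ler_nat R).
have -> : `|numq q|%N%:R = place 0 (r%:A * (N ^ e)%:R) :> R by rewrite Eq Ea absval_int // vn.
rewrite (absvM av) vn.
apply: ltW; apply: le_lt_trans (archi_boundP CN0).
by rewrite ler_wpM2r // hC // inE eqxx.
Qed.

(** By [bounded_rat] the traces of the products of [u m] with a basis of [L] take finitely many
    values, and these traces determine [u m]. *)
Lemma northcott (u : nat -> L) (C : R) : injective u ->
  (forall v : L -> R, away_from N v -> forall j : 'I_(\dim {:L}), v (vbasis {:L})`_j <= 1) ->
  (forall v : L -> R, away_from N v -> forall m, v (u m) <= 1) ->
  ~ (forall m i, gpl i (u m) <= C) .
Proof.
move=> uinj hb hu hC; pose b (j : 'I_(\dim {:L})) := (vbasis {:L})`_j.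
have gp i := gal_place_absval place0 placep (N := N) i.
have C0 : 0 <= C by apply: le_trans (hC 0%N (ord0, 1%g)); exact: absv_ge0.
pose E : R := \sum_(i : 'I_(size s) * gal_of {:L}) \sum_j gpl i (b j).
have bE i j : gpl i (b j) <= E.
  rewrite /E (bigD1 i) //= (bigD1 j) //= -addrA lerDl addr_ge0 // sumr_ge0 // => *.
    exact: absv_ge0.
  by rewrite sumr_ge0 // => *; exact: absv_ge0.
have E0 : 0 <= E by rewrite !sumr_ge0 // => *; rewrite sumr_ge0 // => *; exact: absv_ge0.
have [|e [B hB]] := @bounded_rat (#|{: gal_of {:L}}|%:R * (C * E)); first by rewrite !mulr_ge0.
pose tr m j := \sum_(g : gal_of {:L}) g (u m * b j).
have /choice [a Ha] (mj : nat * 'I_(\dim {:L})) :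
    exists a : int, (`|a| <= B)%N /\ tr mj.1 mj.2 * (N ^ e)%:R = a%:~R.
  case: mj => m j /=; have /vlineP [r Er] : tr m j \in 1%VS.
    have := mem_galTrace galL (memvf (u m * b j)); rewrite /galTrace (eq_bigl xpredT) // => g.
    by rewrite gal_kHom ?sub1v // k1AHom.
  rewrite Er; have [v hv|k ks|a aB Ea] := hB r; last by exists a.
    rewrite -Er; apply: (away_sum hv) => // g _; rewrite rmorphM; apply: (away_M hv).
      exact: hu (away_from_gal g hv) m.
    exact: hb (away_from_gal g hv) j.
  have av := place_absval place0 placep ks.
  have [i Ei] : exists i : 'I_(size s), k = nth 0%N s i.
    have ki : (index k s < size s)%N by rewrite index_mem.
    by exists (Ordinal ki); rewrite nth_index.
  rewrite -Er (le_trans (absv_sum av _ _ _)) //.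
  apply: (@le_trans _ _ (\sum_(g : gal_of {:L}) C * E)); last by rewrite sumr_const mulr_natl.
  apply: ler_sum => g _; rewrite rmorphM (absvM av) Ei.
  by apply: ler_pM; [exact: (absv_ge0 (gp (i, g)))|exact: (absv_ge0 (gp (i, g)))
                   |exact: (hC m (i, g))|exact: (bE (i, g))].
(* The integers [a] are at most [B] in absolute value; adding [B] codes them as ordinals. *)
pose phi m : {ffun 'I_(\dim {:L}) -> 'I_(B + B).+1} := [ffun j => inord (absz (a (m, j) + B%:Z)%R)].
apply: (@no_injection_nat _ phi) => m m' Em; apply: uinj.
have tr_eq j : tr m j = tr m' j.
  have Nn : (N ^ e)%:R != 0 :> L by rewrite natr_numfield_eq0 expn_eq0 negb_and -lt0n N0.
  apply: (mulIf Nn); have [h1 e1] := Ha (m, j); have [h2 e2] := Ha (m', j).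
  rewrite /= in e1 e2; rewrite e1 e2; congr (_%:~R).
  have := congr1 (fun f : {ffun _ -> _} => val (f j)) Em; rewrite !ffunE /=.
  have pos x : (`|x| <= B)%N -> 0 <= x + B%:Z.
    by move=> xB; rewrite -[x]opprK addrC subr_ge0 (le_trans (lez_abs _)) // abszN lez_nat.
  have bd x : (`|x| <= B)%N -> (absz (x + B%:Z)%R < (B + B).+1)%N.
    move=> xB; rewrite ltnS -lez_nat gez0_abs ?pos // PoszD lerD2r.
    by rewrite (le_trans (lez_abs _)) // lez_nat.
  rewrite !inordK ?bd // => h; apply: (addIr B%:Z).
  by rewrite -[LHS]gez0_abs ?pos // -[RHS]gez0_abs ?pos // h.
apply/eqP; rewrite -subr_eq0; apply/eqP; set z := u m - u m'.
have zb j : \sum_(g : gal_of {:L}) g z * g (b j) = 0.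
  transitivity (tr m j - tr m' j); last by rewrite tr_eq subrr.
  rewrite /tr -sumrB; apply: eq_bigr => g _.
  by rewrite -rmorphM -rmorphB -mulrBl.
(* If the sum of [g z * g x] over [g] vanishes for all [x], independence of the automorphisms kills
   the coefficients [g z], in particular [z]. By linearity a basis suffices for [x]. *)
rewrite -[LHS](gal_id {:L} z).
apply: (@gal_independent _ L {:L} xpredT (fun g => g z)) => // x _.
rewrite (coord_vbasis (memvf x)).
under eq_bigr do rewrite linear_sum mulr_sumr.
rewrite exchange_big /= big1 // => j _.
under eq_bigr do rewrite linearZ /= -scalerAr.
by rewrite -scaler_sumr zb scaler0.
Qed.
End Northcott.

(** * Orbits leave the ring of S-integers *)

(** [N] is arbitrary, so that the place can avoid [S] and the primes where the coefficients behave
    badly. *)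
Theorem escaping_orbit (L : splittingFieldType rat) (R : realType) (A B : {poly L})
    (u : nat -> L) (N : nat) :
  galois 1 {:L} -> coprimep A B -> size A = (size B).+1 -> (2 <= size B)%N ->
  injective u -> (forall m, B.[u m] != 0) -> (forall m, u m.+1 = A.[u m] / B.[u m]) ->
  (0 < N)%N ->
  exists (v : L -> R) m, away_from N v /\ 1 < v (u m).
Proof.
move=> galL cop szAB szB uinj Bu urec N0; apply: contrapT => nex.
have B0 : B != 0 by rewrite -size_poly_eq0 -lt0n ltnW.
have /Bezout_eq1_coprimepP [[P Q] /= bez] := cop.
(* Away from [D], the coefficients of [A], [B] and of the Bezout identity are integral, and so is a
   basis of [L]. *)
have [D D0 hD] := integral_away_seq R
  (polyseq A ++ polyseq B ++ polyseq P ++ polyseq Q ++ vbasis {:L}).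
pose M := (D * N)%N; have M0 : (0 < M)%N by rewrite muln_gt0 D0.
have hM (v : L -> R) : away_from M v -> away_from D v /\ away_from N v.
  by move=> hv; split; apply: (away_dvd hv); [exact: dvdn_mulr|exact: dvdn_mull].
have hcoef (v : L -> R) (q : {poly L}) : away_from M v ->
    {subset polyseq q <= polyseq A ++ polyseq B ++ polyseq P ++ polyseq Q ++ vbasis {:L}} ->
    forall i, v q`_i <= 1.
  move=> hv sub i; have [hvD _] := hM v hv; have [lt_i|ge_i] := ltnP i (size q).
    by apply: hD => //; apply/sub/mem_nth.
  by rewrite nth_default //; have [av _ _] := hv; rewrite (absv0 av).
have hu (v : L -> R) : away_from M v -> forall m, v (u m) <= 1.
  move=> hv m; rewrite leNgt; apply/negP => um; apply: nex; exists v, m.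
  by split=> //; have [] := hM v hv.
have hB (v : L -> R) : away_from M v -> forall m, v B.[u m] = 1.
  move=> hv m; have [av _ _] := hv.
  have b1 : v B.[u m] <= 1.
    apply: (away_horner hv) (hu v hv m); apply: hcoef hv _ => x xB.
    by rewrite !mem_cat xB orbT.
  apply/eqP; rewrite eq_le b1 /=.
  (* Substituting [A(u_m) = u_(m+1) B(u_m)] in the Bezout identity exhibits an integral inverse of
     [B(u_m)]. *)
  have E : B.[u m] * (P.[u m] * u m.+1 + Q.[u m]) = 1.
    rewrite urec mulrDr mulrCA [B.[_] * (_ / _)]mulrC divfK // -[LHS]addrC mulrC addrC.
    by rewrite -!hornerM -hornerD bez hornerC.
  rewrite -(absv1 av) -E (absvM av) -[leRHS]mulr1 ler_wpM2l ?(absv_ge0 av) //.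
  apply: (away_D hv); last first.
    apply: (away_horner hv) (hu v hv m); apply: hcoef hv _ => x xQ.
    by rewrite !mem_cat xQ !orbT.
  apply: (away_M hv); last exact: hu.
  apply: (away_horner hv) (hu v hv m); apply: hcoef hv _ => x xP.
  by rewrite !mem_cat xP !orbT.
have [vinf hinf] := archimedean_absval L R.
have /choice [place hplace] k : exists w : L -> R,
    (k = 0%N -> is_absval w /\ forall n, w n%:R = n%:R) /\
    (prime k -> [/\ is_absval w, forall x y, w (x + y) <= Num.max (w x) (w y)
       & w k%:R = k%:R^-1]).
  have [pk|npk] := boolP (prime k); last by exists vinf.
  have [w hw] := padic_absval_exists L R pk; exists w; split=> // k0.
  by rewrite k0 in pk.
have place0 := (hplace 0%N).1 erefl.
have placep p := (hplace p).2.
pose I := ('I_(size (0%N :: primes M)) * gal_of {:L})%type.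
pose w : I -> L -> R := @gal_place L R place M.
have wav i : is_absval (w i) by exact: gal_place_absval.
have /fin_all_exists2 [c c0 hc] (i : I) := log_height_ratmap (wav i) cop szAB B0.
pose l m (i : I) := log_height (w i) (u m).
have ci i : c i <= \sum_i c i.
  by rewrite (bigD1 i) //= lerDl sumr_ge0 // => j _; exact: c0.
have [||||Bd hBd] := @doubling_sum_bounded R I l (\sum_i c i).
- by rewrite sumr_ge0 // => j _; exact: c0.
- by move=> m i; exact: log_height_ge0.
- move=> m i hl; have [h _] := hc i; apply: le_trans (ci i).
  by rewrite /l urec; apply: h; exact: le_lt_trans hl.
- move=> m.
  (* Product formula for [B(u_m)], a unit away from [M]. *)
  have S0 : \sum_i ln (w i B.[u m]) = 0.
    rewrite -[LHS]expRK expR_sum (eq_bigr (fun i => w i B.[u m])) => [|i _]; last first.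
      by rewrite lnK ?posrE ?(absv_gt0 (wav i)) ?Bu.
    by rewrite (@prod_gal_place L R galL place place0 placep M M0 _ (Bu m)) ?ln1 // => v hv; exact: hB.
  have : \sum_i ((size B)%:R * l m i - c i) <= \sum_i (l m.+1 i + ln (w i B.[u m])).
    by apply: ler_sum => i _; rewrite /l urec; have [_ h] := hc i; exact: h.
  rewrite [leRHS]big_split /= S0 addr0 big_split /= sumrN -mulr_sumr; apply: le_trans.
  (* The factor [size B = deg A] is at least 2. *)
  rewrite lerD2r ler_wpM2r ?ler_nat // sumr_ge0 // => i _; exact: log_height_ge0.
apply: (@northcott L R galL place place0 placep M M0 u (expR Bd) uinj) => //.
- move=> v hv j; have [hvD _] := hM v hv; apply: hD => //.
  by rewrite !mem_cat mem_nth ?orbT // size_tuple.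
move=> m i; apply: (@le_trans _ _ (Num.max 1 (w i (u m)))); first by rewrite le_max lexx orbT.
have m0 : 0 < Num.max 1 (w i (u m)) by rewrite lt_max ltr01.
rewrite -[leLHS]lnK ?posrE // ler_expR; apply: le_trans (hBd m).
rewrite (bigD1 i) //= /l /log_height lerDl sumr_ge0 // => j _; exact: log_height_ge0.
Qed.

(** * Orbits at places of good reduction *)

Lemma away_add_eq (L : fieldExtType rat) (R : realType) N (v : L -> R) x y :
  away_from N v -> v x < v y -> v (x + y) = v y.
Proof.
case=> av vU _ xy; apply/eqP; rewrite eq_le.
apply/andP; split; first by rewrite (le_trans (vU _ _)) // ge_max lexx ltW.
rewrite leNgt; apply/negP => h; have := vU (x + y) (- x).
by rewrite addrAC subrr add0r (absvN av) le_max !leNgt h xy.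
Qed.

Lemma away_horner_large (L : fieldExtType rat) (R : realType) N (v : L -> R) (q : {poly L}) x :
  away_from N v -> (forall i, v q`_i <= 1) -> v (lead_coef q) = 1 -> 1 < v x ->
  v q.[x] = v x ^+ (size q).-1.
Proof.
move=> hv hq lq x1; have [av _ _] := hv; have x0 : 0 < v x by apply: lt_trans x1.
have q0 : (0 < size q)%N.
  rewrite size_poly_gt0; apply: contra_eq_neq lq => ->.
  by rewrite lead_coef0 (absv0 av) eq_sym oner_eq0.
rewrite horner_coef -[in LHS](prednK q0) big_ord_recr /= -lead_coefE.
set r := \sum_(i < _) _; have E : v (lead_coef q * x ^+ (size q).-1) = v x ^+ (size q).-1.
  by rewrite (absvM av) lq mul1r (absvX av).
rewrite -[RHS]E; apply: (away_add_eq hv); rewrite E -(ltr_pM2r x0) -(absvM av).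
apply: (@le_lt_trans _ _ (v x ^+ (size q).-1)); last by rewrite ltr_pMr ?exprn_gt0.
rewrite mulr_suml; apply: (away_sum hv) => [|i _]; first by rewrite exprn_ge0 // ltW.
rewrite -mulrA -exprSr (absvM av) (absvX av) -[leRHS]mul1r ler_pM ?(absv_ge0 av) //.
  by rewrite exprn_ge0 // ltW.
by rewrite ler_weXn2l // ltW.
Qed.

(** For each [w] in [S] take a prime [p] with [w p != 1]. No positive power of [w p] is 1, so a
    place with [v p = 1] is not equivalent to [w]. *)
Lemma places_away (K L : fieldExtType rat) (R : realType) (k : {rmorphism K -> L})
    (S : seq (absval K R)) :
  exists2 N : nat, (0 < N)%N & forall (v : L -> R) (hv : is_absval (v \o k)),
    away_from N v -> notin_places S (exist _ (v \o k) hv).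
Proof.
elim: S => [|w S [N N0 hN]]; first by exists 1%N => // v hv _ w [].
have [p pp wp] := absval_prime (proj2_sig w); exists (p * N)%N.
  by rewrite muln_gt0 prime_gt0.
move=> v hv ha w' [<-|hw']; last first.
  by apply: (hN v hv) => //; apply: (away_dvd ha); exact: dvdn_mull.
case=> s s0 /(_ p%:R) /=; rewrite rmorph_nat.
have [_ _ ->] : away_from p v by apply: (away_dvd ha); exact: dvdn_mulr.
have w0 : 0 < proj1_sig w p%:R by rewrite (absv_gt0 (proj2_sig w)) prime_numfield_neq0.
move/(congr1 (@ln R)); rewrite ln1 ln_powR => /esym/eqP.
by rewrite mulf_eq0 gt_eqF //= ln_eq0 // (negPf wp).
Qed.

(** At a place where the coefficients of [A] and [B] are integral and the leading ones are units,
    [v u > 1] makes the leading terms dominate, so [A(u) / B(u)] has absolute value [v u]. The list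
    [E] will control the points of [Z]. *)
Lemma eventually_large (K : fieldExtType rat) (L : splittingFieldType rat) (R : realType)
    (k : {rmorphism K -> L}) (S : seq (absval K R)) (A B : {poly L}) (u : nat -> L) (E : seq L) :
  galois 1 {:L} -> coprimep A B -> size A = (size B).+1 -> (2 <= size B)%N ->
  injective u -> (forall m, B.[u m] != 0) -> (forall m, u m.+1 = A.[u m] / B.[u m]) ->
  exists (v : L -> R) (w : place_outside S) m,
    [/\ forall x, proj1_sig (proj1_sig w) x = v (k x), away_from 1 v,
        forall e, e \in E -> v e <= 1, 1 < v (u m) & forall n, (m <= n)%N -> v (u n) = v (u m)].
Proof.
move=> galL cop szAB szB uinj Bu urec.
have [N N0 hN] := places_away k S.
have [D D0 hD] := integral_away_seq R
  ((lead_coef A)^-1 :: (lead_coef B)^-1 :: polyseq A ++ polyseq B ++ E).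
have DN0 : (0 < D * N)%N by rewrite muln_gt0 D0.
have [v [m [hv um]]] := escaping_orbit R galL cop szAB szB uinj Bu urec DN0.
have hvN : away_from N v by apply: (away_dvd hv); exact: dvdn_mull.
have hvD : away_from D v by apply: (away_dvd hv); exact: dvdn_mulr.
have [av _ _] := hv; have kv := absval_comp_numfield k av.
have v0 := absv0 av.
have coefP (q : {poly L}) : {subset polyseq q <= polyseq A ++ polyseq B ++ E} ->
    forall i, v q`_i <= 1.
  move=> sub i; have [lt_i|ge_i] := ltnP i (size q); last by rewrite nth_default ?v0.
  by apply: hD => //; rewrite !inE sub ?orbT // mem_nth.
have cA := coefP A; have cB := coefP B.
have {}cA : forall i, v A`_i <= 1 by apply: cA => x xA; rewrite mem_cat xA.
have {}cB : forall i, v B`_i <= 1 by apply: cB => x xB; rewrite !mem_cat xB orbT.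
have leadP (q : {poly L}) : q != 0 -> (forall i, v q`_i <= 1) -> v (lead_coef q)^-1 <= 1 ->
    v (lead_coef q) = 1.
  move=> q0 cq; rewrite (absvV av) invf_le1 ?(absv_gt0 av) ?lead_coef_eq0 // => h.
  by apply/eqP; rewrite eq_le h andbT lead_coefE.
have B0 : B != 0 by rewrite -size_poly_eq0 -lt0n ltnW.
have A0 : A != 0 by rewrite -size_poly_eq0 szAB.
have lA : v (lead_coef A) = 1 by apply: leadP => //; apply: hD => //; rewrite inE eqxx.
have lB : v (lead_coef B) = 1 by apply: leadP => //; apply: hD => //; rewrite !inE eqxx orbT.
exists v, (exist _ (exist _ (v \o k) kv) (hN v kv hvN)), m; split=> //.
- by apply: (away_dvd hv); exact: dvd1n.
- by move=> e eE; apply: hD => //; rewrite !inE !mem_cat eE !orbT.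
elim=> [|n IH]; first by rewrite leqn0 => /eqP ->.
rewrite leq_eqVlt => /orP [/eqP ->//|]; rewrite ltnS => /IH En.
have un : 1 < v (u n) by rewrite En.
rewrite urec (absvM av) (absvV av) !(away_horner_large hv) // szAB /= -En.
rewrite -{1}(prednK (n := size B)) ?size_poly_gt0 // exprS mulfK //.
by rewrite expf_neq0 // gt_eqF // (lt_trans ltr01).
Qed.

(** * Moving the fixed point to infinity *)

(** This is [X^d q(1 / X)] for a nominal degree [d], so that zeros at infinity are counted. *)
Definition revpoly (F : nzRingType) (d : nat) (q : {poly F}) := \poly_(i < d.+1) q`_(d - i).

Lemma coef_revpoly (F : nzRingType) d (q : {poly F}) i : (i <= d)%N -> (revpoly d q)`_i = q`_(d - i).
Proof. by move=> h; rewrite coef_poly ltnS h. Qed.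

Lemma map_revpoly (F F' : fieldType) (h : {rmorphism F -> F'}) d (q : {poly F}) :
  map_poly h (revpoly d q) = revpoly d (map_poly h q).
Proof.
apply/polyP => i; rewrite /revpoly coef_map [in LHS]coef_poly [in RHS]coef_poly.
by case: ifP => _; rewrite ?coef_map ?raddf0.
Qed.

Lemma horner_revpoly (F : fieldType) d (q : {poly F}) t : t != 0 -> (size q <= d.+1)%N ->
  (revpoly d q).[t^-1] = q.[t] / t ^+ d.
Proof.
move=> t0 szq; rewrite horner_poly (horner_coef_wide _ szq) mulr_suml.
rewrite (reindex_inj rev_ord_inj); apply: eq_bigr => i _ /=.
rewrite subSS (subKn (ltnSE (ltn_ord i))) -mulrA; congr (_ * _).
have id : (i <= d)%N by exact: ltnSE (ltn_ord i).
by rewrite -(exprVB _ id) ?invr_eq0 // invrK exprVn.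
Qed.

Lemma coef_shift_top (F : idomainType) (d : nat) (q : {poly F}) c : (size q <= d.+1)%N ->
  (q \Po ('X + c%:P))`_d = q`_d.
Proof.
move=> szq; have szX : size ('X + c%:P) = 2 by rewrite size_XaddC.
have szc : size (q \Po ('X + c%:P)) = size q by exact: size_comp_poly2.
have [Eq|lt] := eqVneq (size q) d.+1; last first.
  by rewrite !nth_default ?szc // -ltnS ltn_neqAle lt.
have lX : lead_coef ('X + c%:P) = 1 by apply/eqP; rewrite -monicE monicXaddC.
have := lead_coef_comp q (q := 'X + c%:P); rewrite szX lX expr1n mulr1 => /(_ isT).
by rewrite !lead_coefE szc Eq.
Qed.

(* The coordinate [u = 1 / (x - y)] turns the fixed point [y] of [f / g] into infinity:
   it conjugates [f / g] to [A / B]. *)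
Section FixpointToInfinity.
Variables (L : fieldType) (f g : {poly L}) (y : L) (d : nat).
Hypotheses (cop : coprimep f g) (szd : maxn (size f) (size g) = d.+1)
  (fix_y : f.[y] = y * g.[y]) (gy : g.[y] != 0)
  (my : f^`().[y] - y * g^`().[y] != 0) (d2 : (2 <= d)%N).

Let h := f - y *: g.
(** The image has the coordinate [1 / (f / g - y) = g / (f - y g)]; substitute [x = y + 1 / u] and
    clear the denominators by [u^d]. *)
Definition num_at_infinity := revpoly d (g \Po ('X + y%:P)).
Definition den_at_infinity := revpoly d (h \Po ('X + y%:P)).

Let szf : (size f <= d.+1)%N. Proof. by rewrite -szd leq_maxl. Qed.
Let szg : (size g <= d.+1)%N. Proof. by rewrite -szd leq_maxr. Qed.
Let szh : (size h <= d.+1)%N.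
Proof.
rewrite (leq_trans (size_polyD _ _)) // geq_max szf size_polyN.
by rewrite (leq_trans (size_scale_leq _ _)).
Qed.
Let szc (q : {poly L}) : size (q \Po ('X + y%:P)) = size q.
Proof. by apply: size_comp_poly2; rewrite size_XaddC. Qed.

Lemma horner_num_at_infinity t : t != 0 -> num_at_infinity.[t^-1] = g.[t + y] / t ^+ d.
Proof. by move=> t0; rewrite horner_revpoly ?szc // horner_comp !hornerE. Qed.
Lemma horner_den_at_infinity t : t != 0 -> den_at_infinity.[t^-1] = (f.[t + y] - y * g.[t + y]) / t ^+ d.
Proof. by move=> t0; rewrite horner_revpoly ?szc // horner_comp /h !hornerE. Qed.
(** The coordinate [u = 0] is that of the point [x] at infinity. *)
Lemma horner0_num_at_infinity : num_at_infinity.[0] = g`_d.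
Proof. by rewrite horner_coef0 coef_revpoly // subn0 coef_shift_top. Qed.
Lemma horner0_den_at_infinity : den_at_infinity.[0] = f`_d - y * g`_d.
Proof. by rewrite horner_coef0 coef_revpoly // subn0 coef_shift_top // /h coefB coefZ. Qed.

Lemma size_num_at_infinity : size num_at_infinity = d.+1.
Proof.
apply/eqP; rewrite eqn_leq size_poly ltnNge; apply/negP => /leq_sizeP/(_ d (leqnn _)).
rewrite coef_revpoly // subnn -horner_coef0 horner_comp !hornerE => /eqP.
by rewrite (negPf gy).
Qed.

(** The coefficient of degree [d] is [h(y) = 0]. The next one is [h'(y)], which is [g(y)] times the
    multiplier of [y]: the fixed point must not be superattracting. *)
Lemma size_den_at_infinity : size den_at_infinity = d.
Proof.
apply/eqP; rewrite eqn_leq; apply/andP; split.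
  apply/leq_sizeP => i; rewrite leq_eqVlt => /orP [/eqP <-|lt_di]; last first.
    by rewrite coef_poly ltnS leqNgt lt_di.
  rewrite coef_revpoly // subnn -horner_coef0 horner_comp !hornerE.
  by rewrite fix_y subrr.
have d1 : d = d.-1.+1 by rewrite prednK // ltnW.
rewrite {1}d1 ltnNge; apply/negP => /leq_sizeP/(_ d.-1 (leqnn _)).
rewrite coef_revpoly ?leq_pred // {1}d1 subSnn => /eqP; apply/negP.
have -> : (h \Po ('X + y%:P))`_1 = (h \Po ('X + y%:P))^`().[0].
  by rewrite horner_coef0 coef_deriv.
have dX : ('X + y%:P)^`() = 1 by rewrite derivD derivX derivC addr0.
by rewrite deriv_comp dX mulr1 horner_comp !hornerE /h derivB derivZ !hornerE.
Qed.

(** A common root 0 would give [f] and [g] degrees less than [d]; a common root [al != 0] would give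
    them the common root [1 / al + y]. *)
Lemma coprime_at_infinity (C : closedFieldType) (j : {rmorphism L -> C}) :
  coprimep num_at_infinity den_at_infinity.
Proof.
rewrite -(coprimep_map j); apply: closed_coprimep => al.
rewrite !rootE !map_revpoly; have [->|al0] := eqVneq al 0.
  rewrite !horner_coef0 !coef_revpoly // subn0 !coef_map !fmorph_eq0 !coef_shift_top //.
  rewrite /h coefB coefZ => /eqP gd; rewrite gd mulr0 subr0 => /eqP fd.
  move: szd; rewrite /maxn; case: ifP => _ sz.
    have /eqP := gd; rewrite -[d]/(d.+1.-1) -sz -lead_coefE lead_coef_eq0 => /eqP g0.
    by move: sz; rewrite g0 size_poly0.
  have /eqP := fd; rewrite -[d]/(d.+1.-1) -sz -lead_coefE lead_coef_eq0 => /eqP f0.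
  by move: sz; rewrite f0 size_poly0.
rewrite -[al]invrK !horner_revpoly ?size_map_poly ?szc ?invr_eq0 //.
rewrite !mulf_eq0 !invr_eq0 !expf_eq0 !invr_eq0 (negPf al0) !andbF !orbF.
rewrite !map_comp_poly !horner_comp.
have -> : (map_poly j ('X + y%:P)).[al^-1] = al^-1 + j y.
  by rewrite rmorphD /= map_polyX map_polyC !hornerE.
have -> : map_poly j h = map_poly j f - j y *: map_poly j g by rewrite rmorphB /= map_polyZ.
set z := _ + _; rewrite !hornerE => gz.
rewrite (eqP gz) mulr0 subr0 => fz.
have := coprimep_root (p := map_poly j f) (q := map_poly j g) (x := z).
by rewrite coprimep_map => /(_ cop fz); rewrite gz.
Qed.
End FixpointToInfinity.

(** * Infinite orbits stay away from [Z] at one place *)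

Section Orbit.
Variables (K : fieldExtType rat) (R : realType) (S : seq (absval K R)) (f g : {poly K}).
Hypotheses (cop : coprimep f g) (deg : (2 <= ratmap_deg f g)%N).
Variables (Z : seq (P1 K)) (P : P1 K).
Let orb n := iter n (ratmap f g) P.
Hypothesis orb_inj : injective orb.

Definition avoids_eventually := exists (w : place_outside S) m (eps : R), 0 < eps /\
  forall n z, (m <= n)%N -> z \in Z -> ~ P1_nbhd (proj1_sig w) z eps (orb n).

Lemma orbS n : orb n.+1 = ratmap f g (orb n). Proof. by []. Qed.

Lemma orb_nofix n : ratmap f g (orb n) != orb n.
Proof. by rewrite -orbS; apply/eqP => /orb_inj /eqP; rewrite eqn_leq ltnn. Qed.

(** Here infinity is a fixed point that is not superattracting, so [x] itself is the coordinate; an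
    infinite orbit never meets infinity. *)
Lemma avoids_fix_infinity : size f = (size g).+1 -> avoids_eventually.
Proof.
move=> szfg; have szg : (2 <= size g)%N by move: deg; rewrite /ratmap_deg szfg (maxn_idPl (leqnSn _)).
have orb_some n : exists a, orb n = Some a.
  case E : (orb n) => [a|]; first by exists a.
  by have := orb_nofix n; rewrite E /= szfg ltnSn.
have /choice [a Ea] := orb_some.
have ga n : g.[a n] != 0.
  by apply/negP => g0; have := orbS n; rewrite !Ea /= g0.
have aS n : a n.+1 = f.[a n] / g.[a n].
  by have := orbS n; rewrite !Ea /= (negPf (ga n)) => -[].
have [iota] := numfield_embedding K algC.
have [L [j [k [_ [galL _ _]]]]] := galois_numfield iota 0.
have [||||||v [w [m [wv ha hE um const]]]] := @eventually_large K L R k S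
  (map_poly k f) (map_poly k g) (fun n => k (a n)) (map k (pmap id Z)) galL.
- by rewrite coprimep_map.
- by rewrite !size_map_poly.
- by rewrite size_map_poly.
- by move=> n n' /fmorph_inj E; apply: orb_inj; rewrite !Ea E.
- by move=> n /=; rewrite horner_map fmorph_eq0 ga.
- by move=> n; rewrite !horner_map aS fmorph_div.
set c := v _ in um const; have c0 : 0 < c by rewrite (lt_trans _ um).
(* The orbit ends on the sphere [v x = c > 1]. A finite [z] in [Z] has [v z <= 1], and a neighbour
   of infinity would have [v x > c]. *)
exists w, m, c^-1; rewrite invr_gt0; split=> // n [z|] mn zZ; rewrite Ea /= wv.
  rewrite rmorphB => h; have [av vU _] := ha.
  suff : c <= 1 by rewrite leNgt um.
  rewrite -(const n mn) -(subrK (k z) (k (a n))); apply: (away_D ha).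
    by rewrite ltW // (lt_trans h) // invf_lt1.
  by apply/hE/map_f; rewrite mem_pmap map_id.
by rewrite invrK const // ltxx.
Qed.

Lemma avoids_fix_finite : size f != (size g).+1 -> avoids_eventually.
Proof.
move=> nsz; have [iota] := numfield_embedding K algC.
have [|||y0 [fy0 gy0 my0]] := @nonsuper_fixpoint _ (map_poly iota f) (map_poly iota g).
- by rewrite coprimep_map.
- by rewrite !size_map_poly.
- by rewrite !size_map_poly.
have [L [j [k [y [galL jk jy]]]]] := galois_numfield iota y0.
pose fL := map_poly k f; pose gL := map_poly k g.
have jE (q : {poly K}) : map_poly iota q = map_poly j (map_poly k q).
  by rewrite -map_poly_comp; apply: eq_map_poly => x /=; rewrite jk.
have copL : coprimep fL gL by rewrite coprimep_map.
have fy : fL.[y] = y * gL.[y].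
  by apply: (fmorph_inj j); rewrite rmorphM -!horner_map -!jE jy.
have gy : gL.[y] != 0 by rewrite -(fmorph_eq0 j) -horner_map -jE jy.
have my : fL^`().[y] - y * gL^`().[y] != 0.
  by rewrite -(fmorph_eq0 j) rmorphB rmorphM -!horner_map -!deriv_map -!jE jy.
pose d := ratmap_deg f g.
have szd : maxn (size f) (size g) = d.+1 by move: deg; rewrite /d /ratmap_deg; case: maxn.
have szdL : maxn (size fL) (size gL) = d.+1 by rewrite !size_map_poly.
have fixP x : k x = y -> ratmap f g (Some x) = Some x.
  move=> kx; have gx : g.[x] != 0 by rewrite -(fmorph_eq0 k) -horner_map kx.
  rewrite /= (negPf gx); congr Some; apply: (mulIf gx); rewrite divfK //.
  by apply: (fmorph_inj k); rewrite rmorphM -!horner_map kx.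
have noty n x : orb n = Some x -> k x - y != 0.
  move=> E; rewrite subr_eq0; apply/eqP => /fixP kx.
  by have := orb_nofix n; rewrite E kx eqxx.
(* The value 0 is that of [1 / (x - y)] at infinity. *)
pose u n := if orb n is Some x then (k x - y)^-1 else 0.
pose A := num_at_infinity gL y d; pose B := den_at_infinity fL gL y d.
(* Infinity is not fixed if the orbit meets it, so [deg f <= deg g = d]; coefficients of degree [d]
   cover both remaining cases of [ratmap]. *)
have orbN n : orb n = None -> g`_d != 0 /\ orb n.+1 = Some (f`_d / g`_d).
  move=> E; have := orb_nofix n; rewrite orbS E /=; case: ltnP => // le_fg _.
  have Eg : size g = d.+1 by rewrite -szd (maxn_idPr le_fg).
  have lg : lead_coef g = g`_d by rewrite lead_coefE Eg.
  have gd : g`_d != 0 by rewrite -lg lead_coef_eq0 -size_poly_eq0 Eg.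
  split=> //; case: ltnP => [lt_fg|le_gf].
    by rewrite nth_default ?mul0r // -ltnS -Eg.
  have sfg : size f = size g by apply/eqP; rewrite eqn_leq le_fg.
  by rewrite lg lead_coefE sfg Eg.
have ku x : fL.[k x] = k f.[x] /\ gL.[k x] = k g.[x] by rewrite !horner_map.
have rec n : B.[u n] != 0 /\ u n.+1 = A.[u n] / B.[u n].
  rewrite /u; case E : (orb n) => [x|]; last first.
    have [gd En] := orbN n E; have := noty _ _ En; rewrite En /A /B.
    have kg : k g`_d != 0 by rewrite fmorph_eq0.
    rewrite (horner0_num_at_infinity _ szdL) (horner0_den_at_infinity _ szdL) !coef_map fmorph_div => /= ny.
    have -> : k f`_d - y * k g`_d = (k f`_d / k g`_d - y) * k g`_d.
      by rewrite mulrBl divfK.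
    by split; rewrite ?mulf_neq0 // invfM mulrCA divff ?mulr1.
  have t0 := noty _ _ E; have td := expf_neq0 d t0.
  have [fx gx] := ku x; rewrite /A /B (horner_num_at_infinity _ szdL) // (horner_den_at_infinity _ szdL) //
    subrK fx gx orbS E /=.
  case: ifP => [/eqP g0|/negbT gx0].
    rewrite g0 rmorph0 !mulr0 !mul0r subr0; split=> //.
    rewrite mulf_neq0 ?invr_eq0 // fmorph_eq0; apply/negP => f0.
    by have := coprimep_root cop f0; rewrite g0 eqxx.
  have kg0 : k g.[x] != 0 by rewrite fmorph_eq0.
  have := noty n.+1 (f.[x] / g.[x]); rewrite orbS E /= (negPf gx0) => /(_ erefl).
  rewrite fmorph_div => ny.
  have -> : k f.[x] - y * k g.[x] = (k f.[x] / k g.[x] - y) * k g.[x].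
    by rewrite mulrBl divfK.
  split; first by rewrite !mulf_neq0 ?invr_eq0.
  move: ny kg0 td; set T := (k x - y) ^+ d; set q := _ - y; set r := k _ => q0 r0 T0.
  by field; rewrite q0 r0 T0.
have d2 : (2 <= d)%N by [].
have u_inj : injective u.
  move=> n n'; rewrite /u; case E : (orb n) => [x|]; case E' : (orb n') => [x'|] //.
  - move/invr_inj/addIr/fmorph_inj => xx; apply: orb_inj.
    by rewrite E E' xx.
  - by move/eqP; rewrite invr_eq0 (negPf (noty _ _ E)).
  - by move/esym/eqP; rewrite invr_eq0 (negPf (noty _ _ E')).
  - by move=> _; apply: orb_inj; rewrite E E'.
have [||||||v [w [m [wv ha hE um const]]]] := @eventually_large K L R k S A B u
  [seq (k z - y)^-1 | z <- pmap id Z] galL.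
- exact: (coprime_at_infinity y copL szdL j).
- by rewrite (size_num_at_infinity _ gy) (size_den_at_infinity fy my d2).
- by rewrite (size_den_at_infinity fy my d2).
- exact: u_inj.
- by move=> n; have [] := rec n.
- by move=> n; have [] := rec n.
set c := v _ in um const; have c0 : 0 < c by rewrite (lt_trans _ um).
have [av vU _] := ha; pose e := (v y + 1)^-1.
have y1 : 0 < v y + 1 by rewrite ltr_wpDl // (absv_ge0 av).
(* The orbit ends on the sphere [v (x - y) = 1 / c]. The radius [1 / c] excludes [y] and the other
   points of [Z], whose distance to [y] is at least 1; on the sphere [v x < v y + 1], so [e]
   excludes infinity. *)
exists w, m, (Num.min c^-1 e); split; first by rewrite lt_min !invr_gt0 c0.
move=> n z mn zZ; have := const n mn; rewrite /u; case E : (orb n) => [x|]; last first.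
  by move=> h; move: c0; rewrite -h (absv0 av) ltxx.
move=> vx; have {vx} vx : v (k x - y) = c^-1 by rewrite -vx (absvV av) invrK.
have c1 : c^-1 < 1 by rewrite invf_lt1.
case: z zZ => [z|] zZ /=; rewrite wv.
  rewrite lt_min rmorphB => /andP [h _]; have [kz|kz] := eqVneq (k z) y.
    by move: h; rewrite kz vx ltxx.
  have vz : v (k z - y) < 1.
    have -> : k z - y = - (k x - k z) + (k x - y) by ring.
    by rewrite (le_lt_trans (vU _ _)) // gt_max (absvN av) vx c1 (lt_trans h).
  have : v (k z - y)^-1 <= 1 by apply: hE; apply/mapP; exists z; rewrite // mem_pmap map_id.
  by rewrite (absvV av) invf_le1 ?(absv_gt0 av) ?subr_eq0 // leNgt vz.
move=> h; have {}h : v y + 1 < v (k x).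
  apply: le_lt_trans h; rewrite -[leLHS]invrK lef_pV2 ?posrE ?lt_min ?invr_gt0 ?c0 //.
  by rewrite ge_min lexx orbT.
move: h; apply/negP; rewrite -leNgt -(subrK y (k x)) (le_trans (absvD av _ _)) //.
by rewrite addrC vx lerD2l ltW.
Qed.

Lemma orbit_avoids : avoids_eventually.
Proof. by have [/avoids_fix_infinity|/avoids_fix_finite] := eqVneq (size f) (size g).+1. Qed.
End Orbit.

(** * Closure of the orbit *)

Lemma P1_nbhd_refl (K : fieldType) (R : realType) (v : absval K R) (a : P1 K) (eps : R) :
  0 < eps -> P1_nbhd v a eps a.
Proof. by case: a => [a|] e0 //=; rewrite subrr (absv0 (proj2_sig v)). Qed.

Lemma P1_nbhd_le (K : fieldType) (R : realType) (v : absval K R) (a b : P1 K) (e e' : R) :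
  0 < e -> e <= e' -> P1_nbhd v a e b -> P1_nbhd v a e' b.
Proof.
move=> e0 le_e; case: a b => [a|] [b|] //=; first by move/lt_le_trans; apply.
by apply: le_lt_trans; rewrite lef_pV2 ?posrE // (lt_le_trans e0).
Qed.

Lemma P1_nbhd_separated (K : fieldType) (R : realType) (v : absval K R) (a b : P1 K) :
  a <> b -> exists2 e : R, 0 < e & ~ P1_nbhd v a e b.
Proof.
have av := proj2_sig v; case: a b => [a|] [b|] //= ab.
- exists (proj1_sig v (b - a)); last by rewrite ltxx.
  by rewrite (absv_gt0 av) subr_eq0; apply: contra_notN ab => /eqP ->.
- by exists 1.
- exists (proj1_sig v b + 1)^-1.
    by rewrite invr_gt0 ltr_wpDl // (absv_ge0 av).
  by rewrite invrK; apply/negP; rewrite -leNgt lerDl.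
Qed.

(** A prime above [N] gives a place. Without one, nothing would force the orbit point into [Z]. *)
Lemma place_outside_inhabited (K : fieldExtType rat) (R : realType) (S : seq (absval K R)) :
  inhabited (place_outside S).
Proof.
have [N N0 hN] := places_away (idfun : {rmorphism K -> K}) S.
have [p lt_Np pp] := prime_above N.
have [v [av vU vp]] := padic_absval_exists K R pp.
have h1 : away_from 1 v by split=> //; exact: absv1.
have ha : away_from N v.
  split=> //; apply: (away_coprime h1 pp vp).
  by rewrite prime_coprime //; apply/negP => /(dvdn_leq N0); rewrite leqNgt lt_Np.
by constructor; exact: (exist _ (exist _ (v \o idfun) av) (hN v av ha)).
Qed.

(** Once two iterates agree, subtracting the period brings every index below the later one. *)
Lemma iter_not_injective (T : Type) (F : T -> T) (x : T) :
  ~ injective (fun n => iter n F x) ->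
  exists M, forall n, exists2 m, (m < M)%N & iter n F x = iter m F x.
Proof.
move=> ninj; have [i [j [ij E]]] : exists i j, (i < j)%N /\ iter i F x = iter j F x.
  apply: contrapT => nex; apply: ninj => i j E.
  by case: (ltngtP i j) => // h; case: nex; [exists i, j|exists j, i].
exists j; elim/ltn_ind => n IH; have [lt_nj|le_jn] := ltnP n j; first by exists n.
have [|m mj Em] := IH (n - j + i)%N; first by rewrite -[ltnRHS](subnK le_jn) ltn_add2l.
by exists m => //; rewrite -Em iterD E -iterD subnK.
Qed.

Theorem theorem1 (K : fieldExtType rat) (R : realType)
  (S : seq (absval K R)) (f g : {poly K})
  (Hcop : coprimep f g) (Hdeg : (2 <= ratmap_deg f g)%N)
  (Z : seq (P1 K)) (P : P1 K) :
  forall x : place_outside S -> P1 K,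
    (exists Q : P1 K,
        [/\ in_fwd_orbit (ratmap f g) P Q, Q \in Z & forall v, x v = Q])
    <->
    (@in_adelic_orbit_closure K R S (ratmap f g) P x /\ forall v, x v \in Z).
Proof.
move=> x; split=> [[Q [[n ->] QZ xQ]]|[xcl xZ]].
  split=> [T eps e0|v]; last by rewrite xQ.
  by exists n => v _; rewrite xQ; exact: P1_nbhd_refl.
have [w0] := place_outside_inhabited S.
suff [n xn] : exists n, forall v, x v = iter n (ratmap f g) P.
  by exists (iter n (ratmap f g) P); split=> //; [exists n|rewrite -(xn w0)].
apply: contrapT => nex; pose orb n := iter n (ratmap f g) P.
have /choice [vn Hvn] n : exists v, x v <> orb n.
  apply: contrapT => h; apply: nex; exists n => v.
  by apply: contrapT => xv; apply: h; exists v.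
(* Excluding one orbit point takes one place and one radius, so some basic neighbourhood of [x]
   excludes the first [M] points. *)
have sep M : exists (T : seq (place_outside S)) (eps : R), 0 < eps /\
    forall n, (forall v, List.In v T -> P1_nbhd (proj1_sig v) (x v) eps (orb n)) ->
    forall m, (m < M)%N -> orb n <> orb m.
  elim: M => [|M [T [e [e0 IH]]]]; first by exists [::], 1; split.
  have [e' e'0 he'] := P1_nbhd_separated (proj1_sig (vn M)) (Hvn M).
  exists (vn M :: T), (Num.min e e'); split=> [|n hn m]; first by rewrite lt_min e0.
  have m0 : 0 < Num.min e e' by rewrite lt_min e0.
  rewrite ltnS leq_eqVlt => /orP [/eqP ->|mM].
    move=> En; apply: he'; rewrite -En; apply: P1_nbhd_le m0 _ (hn _ _); last by left.
    by rewrite ge_min lexx orbT.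
  apply: (IH n _ m mM) => v vT; apply: P1_nbhd_le m0 _ (hn _ _); last by right.
  by rewrite ge_min lexx.
have [orb_inj|orb_ninj] := pselect (injective orb); last first.
  (* A finite orbit is excluded entirely, against the closure hypothesis. *)
  have [M hM] := iter_not_injective orb_ninj.
  have [T [e [e0 hT]]] := sep M; have [n hn] := xcl T e e0.
  by have [m mM] := hM n; exact: hT.
(* For an infinite orbit, the place [w] excludes all times from [m] on, and [sep m] the earlier
   points. *)
have [w [m [e [e0 he]]]] := orbit_avoids S Hcop Hdeg Z orb_inj.
have [T [e' [e'0 hT]]] := sep m.
have m0 : 0 < Num.min e e' by rewrite lt_min e0.
have [n hn] := xcl (w :: T) (Num.min e e') m0.
have [lt_nm|le_mn] := ltnP n m.
  apply: (hT n _ n lt_nm erefl) => v vT; apply: P1_nbhd_le m0 _ (hn _ _); last by right.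
  by rewrite ge_min lexx orbT.
apply: (he n (x w) le_mn (xZ w)); apply: P1_nbhd_le m0 _ (hn _ _); last by left.
by rewrite ge_min lexx.
Qed.
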